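(* Let $F$ be a totally real number field of degree $n$ over $\mathbb{Q}$. Fix a weight $k=(k_1,\dots,k_n)\in\mathbb{N}^n$ with $k_j>2$ for all $j$ and a totally positive $\nu\in\mathcal{O}_F^*$. Then there exists a positive constant $n_0$ such that the Hilbert Poincaré series $\mathcal{P}_{k,\nu,\mathcal{I}}$ is not identically zero for every non-zero integral ideal $\mathcal{I}\subseteq\mathcal{O}_F$ with $\mathcal{N}(\mathcal{I})\geq n_0$, where $\mathcal{N}(\mathcal{I})=[\mathcal{O}_F:\mathcal{I}]$.
   Context: $F$ has real embeddings $\sigma_1,\dots,\sigma_n$; $\alpha_j=\sigma_j(\alpha)$; $\alpha\gg0$ means all $\alpha_j>0$. $\mathcal{O}_F^*=\{\mu\in F:\mathrm{tr}(\mu\mathcal{O}_F)\subseteq\mathbb{Z}\}$. $SL_2(\mathcal{O}_F)$ acts on $\mathbb{H}^n$ componentwise via the embeddings by Möbius transformations. For $M=\begin{pmatrix}*&*\\ \gamma&\delta\end{pmatrix}\in SL_2(\mathcal{O}_F)$, $z\in\mathbb{H}^n$, $k\in\mathbb{Z}^n$: $\mu(M,z)^{k}=\prod_{j}(\gamma_jz_j+\delta_j)^{k_j}$; $\mathrm{tr}(mz)=\sum_j m_jz_j$. $\Gamma_0(\mathcal{I})=\{\begin{pmatrix}\alpha&\beta\\ \gamma&\delta\end{pmatrix}\in SL_2(\mathcal{O}_F):\gamma\in\mathcal{I}\}$, $\Gamma_\infty=\{\begin{pmatrix}1&\mu\\0&1\end{pmatrix}:\mu\in\mathcal{O}_F\}$.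 For $k$ with all $k_j>2$ and totally positive $\nu\in\mathcal{O}_F^*$, $\mathcal{P}_{k,\nu,\mathcal{I}}(z)=\sum_{M\in\Gamma_\infty\backslash\Gamma_0(\mathcal{I})}\mu(M,z)^{-k}e^{2\pi i\,\mathrm{tr}(\nu(Mz))}$.
   Formalization: The formal statement adds that k_1+...+k_n is even: since -1 lies in Γ_0(I) but not in Γ_∞, for an odd sum the terms of M and -M cancel and the series is identically zero for every I (e.g. F=Q, k=3, ν=1). *)

(* Defs.v *)
From HB Require Import structures.
From mathcomp Require Import all_boot all_order all_algebra all_field.
From mathcomp Require Import finmap complex.
From mathcomp Require Import all_classical all_reals all_analysis.
From mathcomp Require Import ring.
From mathcomp Require summability.

Set Implicit Arguments.
Unset Strict Implicit.
Unset Printing Implicit Defensive.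

Import Order.TTheory GRing.Theory Num.Theory.
Import numFieldNormedType.Exports.

Local Open Scope classical_set_scope.
Local Open Scope ring_scope.
Local Open Scope complex_scope.

(* [F : fieldExtType rat] is a number field, of degree [\dim {:F}]. *)
Definition totally_real (R : realType) (F : fieldExtType rat) : Prop :=
  forall (f : {rmorphism F -> R[i]}) (x : F), f x \is Num.real.

Definition enumerates_real_embeddings (R : realType) (F : fieldExtType rat)
    (n : nat) (sigma : 'I_n -> {rmorphism F -> R}) : Prop :=
  (forall i j, sigma i =1 sigma j -> i = j) /\
  (forall f : {rmorphism F -> R}, exists j, sigma j =1 f).

Definition integers (F : fieldExtType rat) : set F :=
  [set x | integralOver (intr : int -> F) x].

Definition trace (R : realType) (F : fieldExtType rat) (n : nat)
    (sigma : 'I_n -> {rmorphism F -> R}) (x : F) : R :=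
  \sum_j sigma j x.

Definition dual_integers (R : realType) (F : fieldExtType rat) (n : nat)
    (sigma : 'I_n -> {rmorphism F -> R}) : set F :=
  [set m | forall x, integers x -> trace sigma (m * x) \is a Num.int].

Definition totally_positive (R : realType) (F : fieldExtType rat) (n : nat)
    (sigma : 'I_n -> {rmorphism F -> R}) (x : F) : Prop :=
  forall j, 0 < sigma j x.

Definition integral_ideal (F : fieldExtType rat) (I : set F) : Prop :=
  [/\ I `<=` @integers F,
      I 0,
      forall x y, I x -> I y -> I (x + y)
    & forall a x, integers a -> I x -> I (a * x)].

Definition ideal_cosets (F : fieldExtType rat) (I : set F) : set (set F) :=
  [set [set x + a | a in I] | x in @integers F].

(* The index of [I] in the ring of integers. [fset_set] sends an infinite set to
   the empty one, but a nonzero integral ideal has finite index. *)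
Definition ideal_norm (F : fieldExtType rat) (I : set F) : nat :=
  #|` fset_set (ideal_cosets I)|%fset.

Definition SL2_integers (F : fieldExtType rat) : set 'M[F]_2 :=
  [set M : 'M[F]_2 | (forall i j, integers (M i j)) /\ \det M = 1].

Definition Gamma0 (F : fieldExtType rat) (I : set F) : set 'M[F]_2 :=
  [set M : 'M[F]_2 | SL2_integers M /\ I (M 1 0)].

Definition Gamma_inf (F : fieldExtType rat) : set 'M[F]_2 :=
  [set M : 'M[F]_2 | [/\ M 0 0 = 1, M 1 0 = 0, M 1 1 = 1 & integers (M 0 1)]].

Definition coset_inf (F : fieldExtType rat) (M : 'M[F]_2) : set 'M[F]_2 :=
  [set U *m M | U in @Gamma_inf F].

Definition quotient_inf (F : fieldExtType rat) (I : set F) :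
    set (set 'M[F]_2) :=
  [set coset_inf M | M in Gamma0 I].

Definition upper_half (R : realType) (n : nat) : set ('I_n -> R[i]) :=
  [set z | forall j, 0 < complex.Im (z j)].

Definition denom (R : realType) (F : fieldExtType rat) (n : nat)
    (sigma : 'I_n -> {rmorphism F -> R}) (M : 'M[F]_2) (z : 'I_n -> R[i])
    (j : 'I_n) : R[i] :=
  (sigma j (M 1 0))%:C * z j + (sigma j (M 1 1))%:C.

Definition moebius (R : realType) (F : fieldExtType rat) (n : nat)
    (sigma : 'I_n -> {rmorphism F -> R}) (M : 'M[F]_2) (z : 'I_n -> R[i]) :
    'I_n -> R[i] :=
  fun j => ((sigma j (M 0 0))%:C * z j + (sigma j (M 0 1))%:C)
           / denom sigma M z j.

Definition automorphy (R : realType) (F : fieldExtType rat) (n : nat)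
    (sigma : 'I_n -> {rmorphism F -> R}) (k : 'I_n -> int) (M : 'M[F]_2)
    (z : 'I_n -> R[i]) : R[i] :=
  \prod_j denom sigma M z j ^ k j.

Definition ztrace (R : realType) (F : fieldExtType rat) (n : nat)
    (sigma : 'I_n -> {rmorphism F -> R}) (m : F) (z : 'I_n -> R[i]) : R[i] :=
  \sum_j (sigma j m)%:C * z j.

Definition cexp (R : realType) (w : R[i]) : R[i] :=
  (expR (complex.Re w))%:C * (cos (complex.Im w) +i* sin (complex.Im w)).

Definition poincare_term (R : realType) (F : fieldExtType rat) (n : nat)
    (sigma : 'I_n -> {rmorphism F -> R}) (k : 'I_n -> nat) (nu : F)
    (z : 'I_n -> R[i]) (M : 'M[F]_2) : R[i] :=
  automorphy sigma (fun j => - (k j)%:Z) M z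
  * cexp (2 * (pi : R)%:C * 'i%C * ztrace sigma nu (moebius sigma M z)).

(* Unordered sum (limit over the finite subsets) of the terms of the cosets
   [Gamma_inf * M], each evaluated at a representative [xget 0 C]; the choice is
   immaterial for [nu] in the dual of the integers (see poincare_term_coset).
   The limit is 0 where the series does not converge. *)
Definition poincare (R : realType) (F : fieldExtType rat) (n : nat)
    (sigma : 'I_n -> {rmorphism F -> R}) (k : 'I_n -> nat) (nu : F)
    (I : set F) (z : 'I_n -> R[i]) : R[i] :=
  summability.sum (fun C : set 'M[F]_2 =>
    (if C \in quotient_inf I then poincare_term sigma k nu z (xget 0 C) else 0)
    : R[i]^o).

Lemma det2 (F : fieldType) (M : 'M[F]_2) : \det M = M 0 0 * M 1 1 - M 0 1 * M 1 0.
Proof.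
rewrite (expand_det_row _ 0) !big_ord_recl big_ord0 /cofactor !det_mx11 !mxE /=.
have -> : lift ord0 ord0 = 1 :> 'I_2 by apply: val_inj.
have -> : lift 1 0 = 0 :> 'I_2 by apply: val_inj.
rewrite /= addr0 expr0 mul1r expr1 mulN1r mulrN //.
Qed.

Lemma denom_neq0 (R : realType) (F : fieldExtType rat) (n : nat)
    (sigma : 'I_n -> {rmorphism F -> R}) (M : 'M[F]_2) (z : 'I_n -> R[i]) j :
  \det M = 1 -> upper_half z -> denom sigma M z j != 0.
Proof.
rewrite det2 /denom => detM /(_ j); case: (z j) => a b /= b_gt0.
apply/eqP => -[] /=; rewrite !mul0r !addr0 => /eqP e1 /eqP.
rewrite mulf_eq0 (gt_eqF b_gt0) orbF fmorph_eq0 => /eqP c0.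
move: e1; rewrite c0 rmorph0 mul0r subr0 add0r fmorph_eq0 => /eqP d0.
by move/eqP: detM; rewrite c0 d0 !mulr0 subrr eq_sym oner_eq0.
Qed.

Lemma cexpD (R : realType) (v w : R[i]) : cexp (v + w) = cexp v * cexp w.
Proof.
case: v w => [a b] [c d]; rewrite /cexp /= expRD cosD sinD; congr (_ +i* _) => /=; ring.
Qed.

Lemma cexp_int (R : realType) (m : int) :
  cexp (2 * (pi : R)%:C * 'i%C * (m%:~R : R)%:C) = 1.
Proof.
have cexpn (p : nat) : cexp (2 * (pi : R)%:C * 'i%C * (p%:R : R)%:C) = 1.
  have -> : 2 * (pi : R)%:C * 'i%C * (p%:R : R)%:C = 0 +i* (pi *+ 2 *+ p).
    rewrite -[2](rmorph_nat (real_complex R) 2%N) mulrAC -!rmorphM /=.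
    apply/eqP; rewrite eq_complex /= !mulr0 !mul0r subrr addr0 mulr1 eqxx /=.
    by rewrite mulr_natr mulr_natl.
  rewrite /cexp.
  rewrite /= expR0 -[pi *+ 2 *+ p]add0r (periodicn (@cosD2pi R)).
  have -> : sin (0 + pi *+ 2 *+ p) = 0 :> R.
    elim: p => [|p IH]; first by rewrite addr0 sin0.
    by rewrite mulrS addrCA addrC sinD2pi.
  by rewrite cos0 mul1r.
case: m => p; first exact: cexpn.
have := cexpD (2 * (pi : R)%:C * 'i%C * ((Negz p)%:~R : R)%:C) (2 * (pi : R)%:C * 'i%C * (p.+1%:R : R)%:C).
rewrite cexpn mulr1 => <-; rewrite -mulrDr -rmorphD /= NegzE mulrNz -pmulrn addNr.
by rewrite mulr0 -(cexpn 0%N) mulr0.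
Qed.

Lemma poincare_term_coset (R : realType) (F : fieldExtType rat) (n : nat)
    (sigma : 'I_n -> {rmorphism F -> R}) (k : 'I_n -> nat) (nu : F)
    (z : 'I_n -> R[i]) (U M : 'M[F]_2) :
  dual_integers sigma nu -> upper_half z -> Gamma_inf U -> \det M = 1 ->
  poincare_term sigma k nu z (U *m M) = poincare_term sigma k nu z M.
Proof.
move=> nuP zP [U00 U10 U11 U01] detM.
have l1 : lift ord0 ord0 = 1 :> 'I_2 by apply: val_inj.
have UM i j : (U *m M) i j = U i 0 * M 0 j + U i 1 * M 1 j.
  by rewrite mxE !big_ord_recl big_ord0 addr0 l1.
have dE j : denom sigma (U *m M) z j = denom sigma M z j.
  by rewrite /denom !UM U10 U11 !mul0r !mul1r !add0r.
rewrite /poincare_term; congr (_ * _).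
  by rewrite /automorphy; apply: eq_bigr => j _; rewrite dE.
have -> : ztrace sigma nu (moebius sigma (U *m M) z) =
    ztrace sigma nu (moebius sigma M z) + (trace sigma (nu * U 0 1))%:C.
  rewrite /ztrace /trace rmorph_sum -big_split; apply: eq_bigr => j _ /=.
  rewrite /moebius dE !UM U00 rmorphM rmorphM -mulrDr; congr (_ * _).
  rewrite -[X in _ = _ + X](mulfK (denom_neq0 sigma j detM zP)) -mulrDl.
  congr (_ / _); rewrite /denom !mul1r !rmorphD !rmorphM /=; ring.
have /intrP[m ->] := nuP _ U01.
by rewrite mulrDr cexpD cexp_int mulr1.
Qed.

Lemma poincare_termN (R : realType) (F : fieldExtType rat) (n : nat)
    (sigma : 'I_n -> {rmorphism F -> R}) (k : 'I_n -> nat) (nu : F)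
    (z : 'I_n -> R[i]) (M : 'M[F]_2) :
  poincare_term sigma k nu z (- M) =
  (-1) ^+ (\sum_j k j) * poincare_term sigma k nu z M.
Proof.
have dE j : denom sigma (- M) z j = - denom sigma M z j.
  by rewrite /denom !mxE !rmorphN /=; ring.
have -> : poincare_term sigma k nu z (- M) =
    automorphy sigma (fun j => - (k j)%:Z) (- M) z
    * cexp (2 * (pi : R)%:C * 'i%C * ztrace sigma nu (moebius sigma M z)).
  rewrite /poincare_term; congr (_ * _).
  have -> // : moebius sigma (- M) z = moebius sigma M z.
  apply/funext => j; rewrite /moebius dE !mxE !rmorphN /= invrN mulrN -mulNr.
  congr (_ * _); ring.
have -> : automorphy sigma (fun j => - (k j)%:Z) (- M) z =
    (-1) ^+ (\sum_j k j) * automorphy sigma (fun j => - (k j)%:Z) M z.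
  rewrite /automorphy -prodrXr -big_split; apply: eq_bigr => j _ /=.
  by rewrite dE -!exprnN -!exprVn invrN -[in LHS]mulN1r exprMn.
exact: esym (mulrA _ _ _).
Qed.

(* Since [- 1%:M] is in [Gamma0 I], the terms of [M] and [- M] cancel when the
   weights have an odd sum: nonvanishing needs this sum to be even. *)
Lemma poincare_odd (R : realType) (F : fieldExtType rat) (n : nat)
    (sigma : 'I_n -> {rmorphism F -> R}) (k : 'I_n -> nat) (nu : F)
    (I : set F) (z : 'I_n -> R[i]) :
  integral_ideal I -> dual_integers sigma nu -> upper_half z ->
  odd (\sum_j k j)%N -> poincare sigma k nu I z = 0.
Proof.
move=> [IO I0 ID IM] nuP zP kodd; rewrite /poincare.
set f := (fun C : set _ => _).
pose g (C : set 'M[F]_2) : set 'M[F]_2 := [set - N | N in C].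
have gK : involutive g.
  move=> C; apply/seteqP; split=> [N [_ [N' CN' <-] <-]|N CN]; first by rewrite opprK.
  by exists (- N); [exists N|rewrite opprK].
have detN (M : 'M[F]_2) : \det (- M) = \det M by rewrite -scaleN1r detZ sqrrN expr1n mul1r.
have intN (x : F) : integers x -> integers (- x) by exact: integral_opp.
have gcoset M : g (coset_inf M) = coset_inf (- M).
  apply/seteqP; split=> [_ [_ [U UP <-] <-]|_ [U UP <-]].
    by exists U; rewrite ?mulmxN.
  by exists (U *m M); [exists U|rewrite mulmxN].
have I_N x : I x -> I (- x).
  by move=> Ix; rewrite -mulN1r; apply: IM => //; apply: intN; exact: integral1.
have G0N M : Gamma0 I M -> Gamma0 I (- M).
  move=> [[MO dM] MI]; split; last by rewrite mxE; apply: I_N.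
  by split=> [i j|]; rewrite ?detN // mxE; apply: intN.
have gQ C : quotient_inf I C -> quotient_inf I (g C).
  by move=> [M MP <-]; exists (- M); rewrite ?gcoset //; apply: G0N.
have one_inf : @Gamma_inf F 1%:M.
  by split; rewrite ?mxE //; exact: mxpoly.integral0.
have frep M : Gamma0 I M -> f (coset_inf M) = poincare_term sigma k nu z M.
  move=> MP; rewrite /f mem_set; last by exists M.
  have : coset_inf M (xget 0 (coset_inf M)).
    by apply: xgetPex; exists M; exists 1%:M; rewrite ?mul1mx.
  by move=> [U UP <-]; rewrite poincare_term_coset //; case: MP => -[].
have fg C : f (g C) = - f C.
  have [[M MP <-]|nQ] := pselect (quotient_inf I C).
    rewrite gcoset !frep //; last exact: G0N.
    by rewrite poincare_termN -signr_odd kodd expr1 mulN1r.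
  rewrite /f !memNset ?oppr0 // => /gQ; rewrite gK //.
pose G (A : {fset set 'M[F]_2}) := (g @` A)%fset.
have sG A : summability.partial_sum f (G A) = - summability.partial_sum f A.
  rewrite /summability.partial_sum -!(big_seq_fsetE _ _ predT f) /= big_imfset /=; last first.
    by move=> ? ? _ _; exact: (inv_inj gK).
  by rewrite -sumrN; apply: eq_bigr => C _; rewrite fg.
have Gtot : G @ summability.totally `=>` summability.totally.
  move=> P [A _ AP]; exists (G A) => // B /fsubsetP GAB; apply: AP.
  apply/fsubsetP => C CA; apply/imfsetP; exists (g C); rewrite ?gK //=.
  by apply: GAB; apply/imfsetP; exists C.
pose s : {fset set 'M[F]_2} -> R[i]^o := summability.partial_sum f.
have -> : summability.sum (f : _ -> R[i]^o) = lim (s @ summability.totally) by [].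
have [cs|/dvgP -> //] := pselect (cvg (s @ summability.totally)).
set l := lim _ in cs *.
have FF := @summability.totally_filter (set 'M[F]_2 : choiceType).
have c1 : (fun A => - s A) @ summability.totally --> l.
  have -> : (fun A => - s A) = s \o G by apply/funext => A; rewrite /= [RHS]sG.
  by apply: cvg_trans cs => P /Gtot.
have c2 := cvgN cs.
have e : l = - l.
  have PF : ProperFilter ((fun A => - s A) @ summability.totally) by apply: fmap_proper_filter.
  exact: (@cvg_unique R[i]^o (@norm_hausdorff _ R[i]^o) _ PF l (- l) c1 (c2 _)).
have : l *+ 2 == 0 by rewrite mulr2n {1}e addNr.
by rewrite (mulrn_eq0 (l : R[i])) /= => /eqP.
Qed.

(* Main.v *)
Require Import Defs.
From HB Require Import structures.
From mathcomp Require Import all_boot all_order all_algebra all_field.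
From mathcomp Require Import finmap complex.
From mathcomp Require Import all_classical all_reals all_analysis.
From mathcomp Require Import ring lra.

(** Evaluate the series at z = i y with y_j = c / (2 pi nu_j). The term of a coset with
    bottom row (gamma, delta) then has absolute value
    prod_j r_j^(-k_j) exp(-c / r_j^2), with r_j = |gamma_j z_j + delta_j|.
    The exponential controls it for small r_j, so that it is at most a constant
    (depending on c) times prod_j ((1 + |gamma_j|) (1 + |delta_j|))^(-3/2), which
    is summable over all pairs of integers.

    The rows (0, 1) and (0, -1) contribute 2 exp(-c n). In any other row with
    gamma = 0, delta is a unit, and sum_j delta_j^(-2) exceeds n by a fixed gap, by
    the inequality of arithmetic and geometric means and since norms of nonzero
    integers are at least 1: for c large these rows contribute little. With c fixed,
    the rows with gamma <> 0 contribute part of a tail of a convergent series, since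
    an ideal containing a given nonzero gamma has bounded norm. *)

Set Implicit Arguments.
Unset Strict Implicit.
Unset Printing Implicit Defensive.

Import Order.TTheory GRing.Theory Num.Theory.
Import numFieldNormedType.Exports.

Local Open Scope classical_set_scope.
Local Open Scope ring_scope.
Local Open Scope complex_scope.

(** * Algebraic integers and their conjugates *)

Lemma intr_alg_eq0 (A : algType rat) (m : int) : ((m%:~R : A) == 0) = (m == 0).
Proof. by rewrite -(rmorph_int (in_alg A)) fmorph_eq0 intr_eq0. Qed.

Lemma integral_lead_coefM (A K : comNzRingType) (f : {rmorphism A -> K})
    (p : {poly A}) (x : K) :
  root (map_poly f p) x -> integralOver f (f (lead_coef p) * x).
Proof.
set b := lead_coef p; have bE : b = p`_(size p).-1 by rewrite /b lead_coefE.
have [small|] := leqP (size p) 1.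
  have -> : p = b%:P by rewrite bE; case: (size p) small (size1_polyC small) => [|[|]].
  by rewrite map_polyC /root hornerC => /eqP ->; rewrite mul0r; exact: mxpoly.integral0.
case sp: (size p) bE => [|[|s]] //= bE _.
rewrite /root (@horner_coef_wide _ s.+2); last by rewrite -sp; exact: size_poly.
move=> /eqP px.
(* The polynomial b^s p(X / b), which is monic with coefficients in A. *)
pose c i := if i == s.+1 then 1 else p`_i * b ^+ (s - i).
have cE i : (i < s.+2)%N -> c i * b ^+ i = b ^+ s * p`_i.
  rewrite ltnS leq_eqVlt /c => /orP[/eqP ->|i_le_s].
    by rewrite eqxx mul1r bE exprSr.
  by rewrite ltn_eqF // -mulrA -exprD subnK 1?mulrC.
exists (\poly_(i < s.+2) c i).
  by rewrite monicE lead_coef_poly ?/c //= eqxx ?oner_eq0.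
rewrite /root (@horner_coef_wide _ s.+2); last first.
  by apply: leq_trans (size_poly _ _) _; exact: size_poly.
rewrite (eq_bigr (fun i : 'I_s.+2 => f b ^+ s * ((map_poly f p)`_i * x ^+ i))).
  by rewrite -mulr_sumr px mulr0.
move=> i _; rewrite !coef_map coef_poly ltn_ord exprMn !mulrA.
by rewrite -!rmorphXn -!rmorphM cE.
Qed.

Lemma integers_denominator (F : fieldExtType rat) (x : F) :
  exists d : int, d != 0 /\ integers (d%:~R * x).
Proof.
have /integral_algebraic[p p0 px] : integralOver (in_alg F) x.
  exact: alg_integral.
have [q [a a0 qE]] := rat_poly_scale p.
have q0 : q != 0 by apply: contra_neq p0 => q0; rewrite qE q0 map_poly0 scaler0.
exists (lead_coef q); split; first by rewrite lead_coef_eq0.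
apply: integral_lead_coefM; move: px.
rewrite qE map_polyZ -map_poly_comp rootZ ?fmorph_eq0 ?invr_eq0 ?intr_eq0 //.
by rewrite (eq_map_poly (g := intr)) // => m; rewrite /= scaler_int.
Qed.

Lemma integral_basis (F : fieldExtType rat) (n : nat) :
  \dim {:F} = n ->
  exists2 e : n.-tuple F, basis_of fullv e & forall i : 'I_n, integers e`_i.
Proof.
move=> <-; pose b := vbasis {:F}.
have [d dP] := choice (@integers_denominator F).
have d0 x : (d x)%:~R != 0 :> rat by have [? _] := dP x; rewrite intr_eq0.
exists (map_tuple (fun x => (d x)%:~R *: x) b) => [|i].
  rewrite basisEdim size_tuple leqnn andbT -[X in (X <= _)%VS](span_basis (vbasisP _)).
  apply/span_subvP => x xb; rewrite -[x](scalerK (d0 x)) memvZ // memv_span //.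
  by apply/mapP; exists x.
by rewrite (nth_map 0) ?size_tuple // scaler_int -mulrzl; have [] := dP b`_i.
Qed.

Lemma sum_coord (F : fieldExtType rat) (n : nat) (e : n.-tuple F) (x : F) :
  basis_of fullv e -> x = \sum_i coord e i x *: e`_i.
Proof. by move=> e_basis; exact: coord_basis e_basis (memvf x). Qed.

Definition distinct_morphisms (J : Type) (K L : nzRingType)
    (sigma : J -> {rmorphism K -> L}) : Prop :=
  forall i j, sigma i =1 sigma j -> i = j.

Lemma rmorph_independent (J : eqType) (K L : fieldType)
    (sigma : J -> {rmorphism K -> L}) (s : seq J) (c : J -> L) :
  distinct_morphisms sigma -> uniq s ->
  (forall x, \sum_(j <- s) c j * sigma j x = 0) -> {in s, forall j, c j = 0}.
Proof.
move=> sigma_distinct; elim: s c => [//|i s IH] c /= /andP[i_notin_s s_uniq] c0.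
have c_s0 : {in s, forall j, c j = 0}.
  move=> j js; apply/eqP; apply: contraT => cj0.
  case/eqP: (memPn i_notin_s j js); apply: sigma_distinct => y; apply/eqP.
  rewrite -subr_eq0 -[_ == 0]orFb -(negPf cj0) -mulf_eq0; apply/eqP.
  apply: (IH (fun l => c l * (sigma l y - sigma i y))) js => // x.
  transitivity (\sum_(l <- i :: s) c l * sigma l (y * x) -
      sigma i y * \sum_(l <- i :: s) c l * sigma l x).
    rewrite mulr_sumr -sumrB big_cons rmorphM mulrCA subrr add0r.
    by apply: eq_bigr => l _; rewrite rmorphM; ring.
  by rewrite !c0 mulr0 subrr.
move=> j; rewrite in_cons => /predU1P[->|]; last exact: c_s0.
have := c0 1; rewrite big_cons big_seq big1 ?addr0 ?rmorph1 ?mulr1 // => l ls.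
by rewrite c_s0 ?mul0r.
Qed.

Lemma rmorph_ratZ (F : algType rat) (L : numFieldType) (f : {rmorphism F -> L})
    (q : rat) (x : F) : f (q *: x) = ratr q * f x.
Proof.
rewrite -mulr_algl rmorphM; congr (_ * _).
exact: (fmorph_eq_rat (f \o in_alg F)).
Qed.

Lemma integral_ratr_int (L : archiNumFieldType) (q : rat) :
  integralOver (intr : int -> L) (ratr q) -> (ratr q : L) \is a Num.int.
Proof.
move=> [p p_monic pq].
have p_alg : root (map_poly intr p) (ratr q : algC).
  move: pq; rewrite !(eq_map_poly (g := ratr \o intr)) => [|m|m] /=.
  all: rewrite ?ratr_int //.
  by rewrite !map_poly_comp !fmorph_root.
have : (ratr q : algC) \is a Num.int.
  apply: Cint_rat_Aint; first exact: Crat_rat.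
  apply: root_monic_Aint p_alg (monic_map _ p_monic) _.
  by apply/polyOverP => i; rewrite coef_map /= intr_int.
by move=> /intrP[m]; rewrite -ratr_int => /fmorph_inj ->; rewrite ratr_int intr_int.
Qed.

Section Embeddings.

Variables (F : fieldExtType rat) (n : nat) (L : numFieldType).
Variable sigma : 'I_n -> {rmorphism F -> L}.
Hypothesis sigma_distinct : distinct_morphisms sigma.

Definition embedding_mx (e : n.-tuple F) : 'M[L]_n := \matrix_(i, j) sigma j e`_i.

Definition regular_mx (e : n.-tuple F) (u : F) : 'M[rat]_n :=
  \matrix_(i, l) coord e l (u * e`_i).

Variable e : n.-tuple F.
Hypothesis e_basis : basis_of fullv e.

Lemma embedding_mx_unit : embedding_mx e \in unitmx.
Proof.
rewrite -unitmx_tr unitmxE unitfE; apply/det0P => -[v v0 ve0].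
case/eqP: v0; apply/rowP => j; rewrite mxE.
apply: (rmorph_independent (s := index_enum _) (c := v 0) sigma_distinct) => [|x|] //.
  exact: index_enum_uniq.
rewrite (sum_coord x e_basis); under eq_bigr do rewrite rmorph_sum mulr_sumr.
rewrite exchange_big big1 // => i _ /=.
transitivity (ratr (coord e i x) * (v *m (embedding_mx e)^T) 0 i).
  rewrite mxE mulr_sumr; apply: eq_bigr => l _.
  by rewrite rmorph_ratZ !mxE; ring.
by rewrite ve0 mxE mulr0.
Qed.

Lemma mul_regular_mx (u : F) :
  map_mx ratr (regular_mx e u) *m embedding_mx e =
  embedding_mx e *m diag_mx (\row_j sigma j u).
Proof.
apply/matrixP => i j; rewrite mul_mx_diag !mxE -rmorphM mulrC.
rewrite (sum_coord (u * e`_i) e_basis) rmorph_sum.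
by apply: eq_bigr => l _; rewrite rmorph_ratZ !mxE.
Qed.

Lemma map_regular_mx (u : F) :
  map_mx ratr (regular_mx e u) =
  embedding_mx e *m diag_mx (\row_j sigma j u) *m invmx (embedding_mx e).
Proof. by rewrite -mul_regular_mx mulmxK // embedding_mx_unit. Qed.

Lemma sum_embeddings_mxtrace (u : F) : \sum_j sigma j u = ratr (\tr (regular_mx e u)).
Proof.
rewrite -trace_map_mx map_regular_mx mxtrace_mulC mulKmx ?embedding_mx_unit //.
by rewrite mxtrace_diag; apply: eq_bigr => j _; rewrite mxE.
Qed.

Lemma prod_embeddings_det (u : F) : \prod_j sigma j u = ratr (\det (regular_mx e u)).
Proof.
rewrite -det_map_mx map_regular_mx !det_mulmx mulrC mulrA -det_mulmx.
rewrite mulVmx ?embedding_mx_unit // det1 mul1r det_diag.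
by apply: eq_bigr => j _; rewrite mxE.
Qed.

End Embeddings.

Section IntegralTraceNorm.

Variables (F : fieldExtType rat) (n : nat) (L : archiNumFieldType).
Variable sigma : 'I_n -> {rmorphism F -> L}.
Hypothesis degF : \dim {:F} = n.
Hypothesis sigma_distinct : distinct_morphisms sigma.

Lemma integral_embedding (j : 'I_n) (u : F) :
  integers u -> integralOver (intr : int -> L) (sigma j u).
Proof.
move=> /(integral_rmorph (sigma j)).
by have -> : sigma j \o intr = intr by apply/funext => m; rewrite /= rmorph_int.
Qed.

Lemma sum_embeddings_int (u : F) : integers u -> \sum_j sigma j u \is a Num.int.
Proof.
move=> uO; have [e e_basis _] := integral_basis degF.
have traceE := sum_embeddings_mxtrace sigma_distinct e_basis u.
rewrite traceE; apply: integral_ratr_int; rewrite -traceE.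
elim/big_ind: _ => [||j _]; [exact: mxpoly.integral0|exact: integral_add|].
exact: integral_embedding.
Qed.

Lemma prod_embeddings_int (u : F) : integers u -> \prod_j sigma j u \is a Num.int.
Proof.
move=> uO; have [e e_basis _] := integral_basis degF.
have normE := prod_embeddings_det sigma_distinct e_basis u.
rewrite normE; apply: integral_ratr_int; rewrite -normE.
elim/big_ind: _ => [||j _]; [exact: integral1|exact: integral_mul|].
exact: integral_embedding.
Qed.

Lemma prod_norm_embeddings_ge1 (u : F) :
  integers u -> u != 0 -> 1 <= \prod_j `|sigma j u|.
Proof.
move=> uO u0; rewrite -normr_prod norm_intr_ge1 ?prod_embeddings_int //.
by apply/prodf_neq0 => j _; rewrite fmorph_eq0.
Qed.

End IntegralTraceNorm.

Lemma finite_set_bounded_int (R : archiRealDomainType) (T : Type) (I : finType)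
    (f : T -> I -> R) (B : I -> R) (A : set T) :
  (forall x i, A x -> f x i \is a Num.int) ->
  (forall x i, A x -> `|f x i| <= B i) ->
  {in A &, forall x y, f x =1 f y -> x = y} -> finite_set A.
Proof.
move=> f_int f_le f_inj; pose N := (\max_i Num.truncn (B i)).+1.
pose p x := [ffun i => inord (Num.truncn (f x i + N%:R))] : {ffun I -> 'I_(N + N).+1}.
have pE x i : A x -> (p x i)%:R = f x i + N%:R.
  move=> Ax; have f_leN : `|f x i| <= N%:R.
    apply: le_trans (f_le x i Ax) _; apply: le_trans (ltW (truncnS_gt _)) _.
    by rewrite ler_nat ltnS (leq_bigmax (F := fun i => Num.truncn (B i))).
  move: f_leN; rewrite ler_norml => /andP[f_geN f_leN].
  have fN_nat : f x i + N%:R \is a Num.nat.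
    by rewrite natrEint rpredD ?f_int ?intr_nat //= -lerBlDr sub0r.
  by rewrite ffunE inordK ?truncnK // ltnS -(ler_nat R) truncnK // natrD lerD2r.
rewrite -(eq_finite_set (@inj_card_eq _ _ A p _)); first exact: finite_finset.
move=> x y /set_mem Ax /set_mem Ay pxy; apply: f_inj; rewrite ?inE // => i.
by apply: (addIr N%:R); rewrite -!pE // pxy.
Qed.

Lemma leif_sum_prod_ge1 (K : realFieldType) (I : finType) (a : I -> K) :
  (forall i, 0 <= a i) -> 1 <= \prod_i a i ->
  #|I|%:R <= \sum_i a i ?= iff [forall i, a i == 1].
Proof.
move=> a0 prod_ge1; have [I0|I_gt0] := posnP #|I|.
  have noI (i : I) : false by have := fintype0 i I0.
  rewrite I0 big1 => [|i _]; last by have := noI i.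
  by split=> //; rewrite eqxx; apply/esym/forallP => i; have := noI i.
have n_gt0 : 0 < #|I|%:R :> K by rewrite ltr0n.
have [AGM_le AGM_eq] := @leif_AGM _ _ predT a (fun i _ => a0 i).
have mean_ge1 : 1 <= (\sum_i a i) / #|I|%:R.
  rewrite leNgt; apply/negP => mean_lt1.
  have := le_trans prod_ge1 AGM_le; rewrite leNgt exprn_ilt1 ?gtn_eqF //.
  by rewrite divr_ge0 ?sumr_ge0.
split; first by rewrite -[leLHS]mul1r -ler_pdivlMr.
apply/eqP/forallP => [sumE i|a1]; last first.
  by rewrite (eq_bigr (fun=> 1)) ?sumr_const // => i _; exact/eqP.
have : \prod_(i in I) a i == ((\sum_(i in I) a i) / #|I|%:R) ^+ #|I|.
  rewrite eq_le AGM_le -sumE divff ?gt_eqF // expr1n; exact: prod_ge1.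
rewrite AGM_eq => /forall_inP a_eq; apply/eqP.
apply: (mulfI (negbT (gt_eqF n_gt0))); rewrite mulr1 [RHS]sumE mulr_natl -sumr_const.
by apply: eq_bigr => j _; exact/esym/eqP/(forall_inP (a_eq j isT)).
Qed.

Section BoundedIntegers.

Variables (F : fieldExtType rat) (n : nat) (R : archiRealFieldType).
Variable sigma : 'I_n -> {rmorphism F -> R}.
Hypothesis degF : \dim {:F} = n.
Hypothesis sigma_distinct : distinct_morphisms sigma.

Definition bounded_integers (B : R) : set F :=
  [set x | integers x /\ forall j, `|sigma j x| <= B].

Lemma eq_embeddings (x y : F) : (forall j, sigma j x = sigma j y) -> x = y.
Proof.
have n_gt0 : (0 < n)%N by rewrite -degF adim_gt0.
by move=> /(_ (Ordinal n_gt0)); exact: fmorph_inj.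
Qed.

(* For a basis e of integers, the rational integers tr(e_i x) determine x and are
   bounded in terms of its conjugates. *)
Lemma finite_bounded_integers (B : R) : finite_set (bounded_integers B).
Proof.
have [e e_basis eO] := integral_basis degF.
apply: (@finite_set_bounded_int R F 'I_n (fun x i => \sum_j sigma j (e`_i * x))
  (fun i => \sum_j `|sigma j e`_i| * B)) => [x i [xO _]|x i [_ xB]|].
- by apply: sum_embeddings_int => //; exact: integral_mul (eO i) xO.
- apply: le_trans (ler_norm_sum _ _ _) _; apply: ler_sum => j _.
  by rewrite rmorphM normrM ler_wpM2l.
- move=> x y _ _ xy; apply: eq_embeddings.
  have /rowP rowE : \row_j sigma j x = \row_j sigma j y.
    apply: (can_inj (mulmxK (_ : (embedding_mx sigma e)^T \in unitmx))).
      by rewrite unitmx_tr embedding_mx_unit.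
    apply/rowP => i; have := xy i; rewrite !mxE => xyi.
    transitivity (\sum_j sigma j (e`_i * x)).
      by apply: eq_bigr => j _; rewrite !mxE rmorphM mulrC.
    by rewrite xyi; apply: eq_bigr => j _; rewrite !mxE rmorphM mulrC.
  by move=> j; have := rowE j; rewrite !mxE.
Qed.

Lemma sum_sqr_embeddings_gt (u : F) :
  integers u -> u != 0 -> u != 1 -> u != -1 -> n%:R < \sum_j sigma j u ^+ 2.
Proof.
move=> uO u0 u1 uN1.
have norm_ge1 := prod_norm_embeddings_ge1 degF sigma_distinct uO u0.
have prod_ge1 : 1 <= \prod_j sigma j u ^+ 2.
  by rewrite prodrXl -real_normK ?num_real // normr_prod exprn_ege1.
have := leif_sum_prod_ge1 (fun j => sqr_ge0 _) prod_ge1.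
rewrite card_ord => /lt_leif ->; apply/negP => /forallP sqr_eq1.
have : u ^+ 2 = 1.
  by apply: eq_embeddings => j; rewrite rmorphXn rmorph1; exact/eqP.
by move/eqP; rewrite sqrf_eq1 (negPf u1) (negPf uN1).
Qed.

Lemma sum_sqr_embeddings_gap :
  exists2 c : R, 0 < c & forall u, integers u -> u != 0 -> u != 1 -> u != -1 ->
    n%:R + c <= \sum_j sigma j u ^+ 2.
Proof.
pose excess u : R := \sum_j sigma j u ^+ 2 - n%:R.
have [s sE] := (finite_seqP _).1 (finite_bounded_integers (n%:R + 1)).
exists (\big[Num.min/1]_(u <- s | 0 < excess u) excess u); first exact: lt_bigmin.
move=> u uO u0 u1 uN1; rewrite -lerBrDl.
have [excess_ge1|excess_lt1] := leP 1 (excess u).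
  exact: le_trans (bigmin_le_id _ _ _ _) _.
apply: ge_bigmin_seq; last by rewrite subr_gt0 sum_sqr_embeddings_gt.
suff : bounded_integers (n%:R + 1) u by rewrite sE.
split=> // j; rewrite -[leRHS]ger0_norm ?addr_ge0 // -ler_sqr ?nnegrE //.
rewrite !real_normK ?num_real //.
apply: le_trans (_ : _ <= n%:R + 1) _; last by rewrite ler_eXnr // lerDr.
apply: le_trans (_ : \sum_j sigma j u ^+ 2 <= _); last by rewrite -lerBlDl ltW.
by rewrite (bigD1 j) //= lerDl sumr_ge0 // => i _; exact: sqr_ge0.
Qed.

End BoundedIntegers.

(** * Norms of ideals *)

Lemma ideal_norm_le_size (F : fieldExtType rat) (I : set F) (s : seq F) :
  integral_ideal I -> (forall x, integers x -> exists2 y, y \in s & I (x - y)) ->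
  (ideal_norm I <= size s)%N.
Proof.
move=> [IO _ ID IM] s_res; pose coset x : set F := [set x + a | a in I].
have IN x : I x -> I (- x).
  by rewrite -mulN1r; apply: IM; apply: integral_opp; exact: integral1.
have coset_sub x y : I (x - y) -> coset x `<=` coset y.
  move=> Ixy _ [a Ia <-]; exists (x - y + a); first exact: ID.
  by rewrite addrA [y + _]addrC subrK.
have cosets_sub : ideal_cosets I `<=` [set` map coset s].
  move=> _ [x xO <-]; have [y ys Ixy] := s_res x xO.
  have -> : [set x + a | a in I] = coset y.
    by apply/seteqP; split; apply: coset_sub; rewrite // -opprB; exact: IN.
  exact: map_f.
have cosets_fin : finite_set (ideal_cosets I).
  by apply: sub_finite_set cosets_sub _; exact: finite_seq.
rewrite /ideal_norm -(size_map coset s); apply: uniq_leq_size; first exact: fset_uniq.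
by move=> C; rewrite in_fset_set // inE => /cosets_sub.
Qed.

Section IdealNorm.

Variables (F : fieldExtType rat) (n : nat) (R : archiRealFieldType).
Variable sigma : 'I_n -> {rmorphism F -> R}.
Hypothesis degF : \dim {:F} = n.
Hypothesis sigma_distinct : distinct_morphisms sigma.

Lemma finite_residues (d : int) : d != 0 ->
  exists s : seq F, forall x, integers x ->
    exists2 y, y \in s & exists2 z, integers z & x - y = z * d%:~R.
Proof.
move=> d0; have [e e_basis eO] := integral_basis degF.
have d0' : d%:~R != 0 :> rat by rewrite intr_eq0.
pose B : R := \sum_j \sum_(i < n) `|d%:~R| * `|sigma j e`_i|.
have [s sE] := (finite_seqP _).1 (finite_bounded_integers degF sigma_distinct B).
exists s => x xO; pose q (i : 'I_n) := coord e i x; pose f i := Num.floor (q i / d%:~R).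
pose z := \sum_(i < n) (f i)%:~R * e`_i; pose y := x - z * d%:~R.
have zO : integers z.
  rewrite /z; elim/big_ind: _ => [|u v|i _].
  - exact: mxpoly.integral0.
  - exact: integral_add.
  - exact: integral_mul (integral_id _ _) (eO i).
have yE : y = \sum_i (q i - (f i)%:~R * d%:~R) *: e`_i.
  rewrite /y {1}(sum_coord x e_basis) mulr_suml -sumrB; apply: eq_bigr => i _.
  by rewrite scalerBl -scalerA !scaler_int mulrzl mulrzr mulrzAC.
exists y; last by exists z => //; rewrite subKr.
have : bounded_integers sigma B y; last by rewrite sE.
split=> [|j]; first by apply: integral_sub xO (integral_mul zO (integral_id _ _)).
rewrite /B (bigD1 j) //= ler_wpDr ?sumr_ge0 // => [i _|].
  by apply: sumr_ge0 => l _; rewrite mulr_ge0.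
rewrite yE rmorph_sum; apply: le_trans (ler_norm_sum _ _ _) _; apply: ler_sum => i _.
rewrite rmorph_ratZ normrM ler_wpM2r // -(ratr_int R d) -!ratr_norm ler_rat.
rewrite -[q i](divfK d0') -mulrBl normrM ler_piMl //.
rewrite ger0_norm ?subr_ge0 ?floor_le //.
by rewrite lerBlDl ltW // -[1]/(1%:~R) -intrD floorD1_gt.
Qed.

Lemma ideal_norm_le_mem (g : F) : g != 0 ->
  exists b : nat, forall I, integral_ideal I -> I g -> (ideal_norm I <= b)%N.
Proof.
move=> g0; have [d [d0 dO]] := integers_denominator g^-1.
have [s s_res] := finite_residues d0; exists (size s) => I I_ideal Ig.
apply: ideal_norm_le_size => // x /s_res[y ys [z zO xyE]]; exists y => //.
have [_ _ _ IM] := I_ideal.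
by rewrite xyE -[d%:~R](divfK g0) mulrA; apply: IM Ig; exact: integral_mul.
Qed.

Lemma ideal_norm_le_finite (A : set F) : finite_set A ->
  exists b : nat, forall I g,
    integral_ideal I -> A g -> g != 0 -> I g -> (ideal_norm I <= b)%N.
Proof.
move=> /finite_seqP[s ->].
have bound (g : F) : exists b : nat,
    g != 0 -> forall I, integral_ideal I -> I g -> (ideal_norm I <= b)%N.
  have [->|g0] := eqVneq g 0; first by exists 0%N.
  by have [b bP] := ideal_norm_le_mem g0; exists b.
have [b bP] := choice bound; exists (\max_(g <- s) b g)%N => I g I_ideal gs g0 Ig.
by apply: leq_trans (bP g g0 I I_ideal Ig) _; exact: (leq_bigmax_seq (F := b)).
Qed.

End IdealNorm.

(** * Unordered sums *)

Section Esum.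

Variables (R : realType) (T : choiceType).
Implicit Types (a : T -> \bar R) (A B : set T).

Lemma sum_fset_le_esum (X : {fset T}) A (u : T -> R) :
  [set` X] `<=` A -> ((\sum_(x <- X) u x)%:E <= \esum_(x in A) (u x)%:E)%E.
Proof.
move=> XA; apply: ereal_sup_ubound; exists [set` X] => //.
by rewrite fsbig_finite // set_fsetK sumEFin.
Qed.

Lemma esum_le_EFin A (u : T -> R) (K : R) :
  (forall X : {fset T}, [set` X] `<=` A -> \sum_(x <- X) u x <= K) ->
  (\esum_(x in A) (u x)%:E <= K%:E)%E.
Proof.
move=> leK; apply: ge_ereal_sup => _ [X [X_fin XA] <-].
by rewrite fsbig_finite // sumEFin lee_fin leK // fset_setK.
Qed.

Lemma le_esum_subset A B a : A `<=` B -> (forall x, B x -> 0 <= a x)%E ->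
  (\esum_(x in A) a x <= \esum_(x in B) a x)%E.
Proof.
move=> AB a0; rewrite [leRHS](esumID A) // (setIidr AB) leeDl // esum_ge0 // => x [].
by move=> Bx _; exact: a0.
Qed.

Lemma le_esumU A B a : (forall x, (A `|` B) x -> 0 <= a x)%E ->
  (\esum_(x in A `|` B) a x <= \esum_(x in A) a x + \esum_(x in B) a x)%E.
Proof.
move=> a0; rewrite (esumID A) // setUK leeD2l // le_esum_subset => [//|x [[]]//|x Bx].
by apply: a0; right.
Qed.

Lemma esumZl A a (r : R) : 0 <= r -> (forall x, 0 <= a x)%E ->
  (\esum_(x in A) (r%:E * a x) = r%:E * \esum_(x in A) a x)%E.
Proof.
move=> r0 a0; rewrite /esum -ereal_supZl //; last first.
  by apply/set0P; exists 0%E, set0; [exact: fsets_set0|rewrite fsbig_set0].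
congr ereal_sup; apply/seteqP; split=> [_ [X XA <-]|_ [_ [X XA <-] <-]].
  by exists (\sum_(x \in X) a x)%E; [exists X|rewrite ge0_mule_fsumr].
by exists X; rewrite ?ge0_mule_fsumr.
Qed.

Lemma esum_tail A a (e : R) : (forall x, A x -> 0 <= a x)%E ->
  (\esum_(x in A) a x < +oo)%E -> 0 < e ->
  exists2 X, finite_set X & (\esum_(x in A `\` X) a x < e%:E)%E.
Proof.
move=> a0 sum_lty e0.
have sum_fin : \esum_(x in A) a x \is a fin_num.
  by rewrite ge0_fin_numE // esum_ge0.
have [_ [X [X_fin XA] <-] X_lt] := ub_ereal_sup_adherent e0 sum_fin.
exists X => //; move: sum_fin X_lt.
rewrite -/(\esum_(x in A) a x) (esumID X) // (setIidr XA) -setDE.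
rewrite esum_fset // => [|x /set_mem/XA/a0//].
rewrite fin_numD => /andP[]; case: (\sum_(x \in X) a x)%E => // s _.
by case: (esum _ _) => //= t _; rewrite !lte_fin; lra.
Qed.

End Esum.

Lemma esum_setX_lty (R : realType) (S T : choiceType) (A : set S) (B : set T)
    (u : S -> R) (v : T -> R) :
  (forall x, 0 <= u x) -> (forall y, 0 <= v y) ->
  (\esum_(x in A) (u x)%:E < +oo)%E -> (\esum_(y in B) (v y)%:E < +oo)%E ->
  (\esum_(p in A `*` B) (u p.1 * v p.2)%:E < +oo)%E.
Proof.
move=> u0 v0 u_lty; have : (0 <= \esum_(y in B) (v y)%:E)%E.
  by apply: esum_ge0 => y _; rewrite lee_fin.
case sumv : (\esum_(y in B) (v y)%:E)%E => [r| |] // r0 _.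
rewrite -(@esum_esum _ _ _ A (fun=> B) (fun x y => (u x * v y)%:E)); last first.
  by move=> x y _ _; rewrite lee_fin mulr_ge0.
rewrite (eq_esum (b := fun x => (r%:E * (u x)%:E)%E)) => [|x _].
  by rewrite esumZl ?lte_mul_pinfty // => x; rewrite lee_fin.
under eq_esum do rewrite EFinM.
by rewrite esumZl ?sumv 1?muleC // => y; rewrite lee_fin.
Qed.

Lemma partial_sumE (V : zmodType) (T : choiceType) (f : T -> V) (X : {fset T}) :
  summability.partial_sum f X = \sum_(x <- X) f x.
Proof. by rewrite /summability.partial_sum -(big_seq_fsetE _ _ predT f). Qed.

Lemma dist_sum_fset_le_esum (R : realType) (V : normedZmodType R) (T : choiceType)
    (f : T -> V) (X Y : {fset T}) : (X `<=` Y)%fset ->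
  (`|\sum_(x <- Y) f x - \sum_(x <- X) f x|%:E <=
   \esum_(x in ~` [set` X]) `|f x|%:E)%E.
Proof.
move=> XY; rewrite (big_fsetID _ (mem X)) /=.
have -> : [fset x in Y | x \in X]%fset = X.
  apply/fsetP => x; rewrite !inE andbC.
  by case: (boolP (x \in X)) => // /(fsubsetP XY) ->.
rewrite addrAC subrr add0r.
have := @sum_fset_le_esum R T [fset x in Y | x \notin X]%fset (~` [set` X]).
move=> /(_ (fun x => `|f x|)) le_esum; apply: le_trans (le_esum _).
  by rewrite lee_fin ler_norm_sum.
by move=> x; rewrite /= !inE => /andP[_ /negP].
Qed.

Lemma is_cvg_partial_sum (R : realType) (T : choiceType) (u : T -> R) :
  (\esum_(x in setT) `|u x|%:E < +oo)%E ->
  cvg (summability.partial_sum u @ summability.totally).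
Proof.
move=> u_lty; have FF := @summability.totally_filter T.
apply: cauchy_cvg; apply: cauchy_exP => e e0.
have u_ge0 x : setT x -> (0 <= `|u x|%:E)%E by rewrite lee_fin.
have [Z /finite_fsetP[X ->]] := esum_tail u_ge0 u_lty e0.
rewrite setTD => tail_lt; exists (\sum_(x <- X) u x), X => //= Y XY.
rewrite /ball /= distrC partial_sumE -lte_fin.
exact: le_lt_trans (dist_sum_fset_le_esum _ XY) tail_lt.
Qed.

Section ComplexSum.

Variables (R : realType) (T : choiceType).
Implicit Types (z : R[i]) (f : T -> R[i]).

Import Normc.

Lemma normr_normc z : `|z| = (normc z)%:C. Proof. by case: z. Qed.

Lemma Re_le_normc z : `|complex.Re z| <= normc z.
Proof. by rewrite -lecR -normr_normc normc_ge_Re. Qed.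

Lemma Im_le_normc z : `|complex.Im z| <= normc z.
Proof. by case: z => x y; rewrite /normc -sqrtr_sqr ler_wsqrtr //= lerDr sqr_ge0. Qed.

Lemma normc_le_ReIm z : normc z <= `|complex.Re z| + `|complex.Im z|.
Proof.
case: z => x y; have := @le_normcD R (x +i* 0) (0 +i* y).
by rewrite /normc /= expr0n !addr0 !add0r !sqrtr_sqr.
Qed.

Lemma Re_sum (s : seq T) f :
  complex.Re (\sum_(x <- s) f x) = \sum_(x <- s) complex.Re (f x).
Proof. exact: (raddf_sum (@complex.Re R : Rcomplex R -> R)). Qed.

Lemma Im_sum (s : seq T) f :
  complex.Im (\sum_(x <- s) f x) = \sum_(x <- s) complex.Im (f x).
Proof. exact: (raddf_sum (@complex.Im R : Rcomplex R -> R)). Qed.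

Lemma is_cvg_partial_sum_complex f :
  (\esum_(x in setT) (normc (f x))%:E < +oo)%E ->
  cvg ((summability.partial_sum f : {fset T} -> R[i]^o) @ summability.totally).
Proof.
move=> f_lty; have FF := @summability.totally_filter T.
have /cvg_ex[/= a Re_cvg] : cvg (summability.partial_sum (fun x => complex.Re (f x))
    @ summability.totally).
  apply: is_cvg_partial_sum; apply: le_lt_trans f_lty; apply: le_esum => x _.
  by rewrite lee_fin Re_le_normc.
have /cvg_ex[/= b Im_cvg] : cvg (summability.partial_sum (fun x => complex.Im (f x))
    @ summability.totally).
  apply: is_cvg_partial_sum; apply: le_lt_trans f_lty; apply: le_esum => x _.
  by rewrite lee_fin Im_le_normc.
apply/cvg_ex; exists (a +i* b); apply/cvgrPdist_lt => e.
rewrite ltcE => /andP[/eqP Im_e0 /= e0].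
have e2 : 0 < complex.Re e / 2 by rewrite divr_gt0.
near=> X; rewrite normr_normc ltcE /= Im_e0 eqxx /=.
apply: le_lt_trans (normc_le_ReIm _) _; rewrite [ltRHS]splitr partial_sumE.
have -> : complex.Re (a +i* b - \sum_(x <- X) f x) = a - \sum_(x <- X) complex.Re (f x).
  by rewrite -Re_sum; case: (\sum_(x <- X) f x).
have -> : complex.Im (a +i* b - \sum_(x <- X) f x) = b - \sum_(x <- X) complex.Im (f x).
  by rewrite -Im_sum; case: (\sum_(x <- X) f x).
rewrite ltrD // -partial_sumE; near: X.
  exact: (cvgrPdist_lt _ _).1 Re_cvg _ e2.
exact: (cvgrPdist_lt _ _).1 Im_cvg _ e2.
Unshelve. all: by end_near.
Qed.

Lemma summability_sum_neq0 f (X : {fset T}) :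
  (\esum_(x in ~` [set` X]) (normc (f x))%:E < (normc (\sum_(x <- X) f x))%:E)%E ->
  summability.sum (f : T -> R[i]^o) <> 0.
Proof.
move=> tail_lt sum0; have FF := @summability.totally_filter T.
have normf_ge0 x : (0 <= (normc (f x))%:E)%E.
  by rewrite lee_fin (le_trans _ (Re_le_normc _)).
have tail_fin : \esum_(x in ~` [set` X]) (normc (f x))%:E \is a fin_num.
  by rewrite ge0_fin_numE ?esum_ge0 // (lt_trans tail_lt) ?ltry.
have f_lty : (\esum_(x in setT) (normc (f x))%:E < +oo)%E.
  rewrite (esumID [set` X]) // !setTI esum_fset // fsumEFin //.
  by rewrite lte_add_pinfty ?ltry // ltey_eq tail_fin.
have f_cvg0 :
    (summability.partial_sum f : _ -> R[i]^o) @ summability.totally --> (0 : R[i]^o).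
  have := is_cvg_partial_sum_complex f_lty.
  by rewrite -[lim _]/(summability.sum _) sum0.
move: tail_lt; rewrite -(fineK tail_fin) lte_fin; set tail := fine _ => tail_lt.
have gap_gt0 : 0 < (normc (\sum_(x <- X) f x) - tail)%:C by rewrite ltcR subr_gt0.
have [Y _ /(_ (X `|` Y)%fset)] := (cvgrPdist_lt _ _).1 f_cvg0 _ gap_gt0.
rewrite /= fsubsetUr sub0r normrN partial_sumE normr_normc ltcR => /(_ isT) small.
have := @dist_sum_fset_le_esum R (Rcomplex R) T f X _ (fsubsetUl _ Y).
rewrite -[leRHS](fineK tail_fin) lee_fin => dist_le.
have := @le_normcD R (\sum_(x <- (X `|` Y)%fset) f x)
  (- (\sum_(x <- (X `|` Y)%fset) f x - \sum_(x <- X) f x)).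
rewrite subKr normcN => /le_lt_trans /(_ (ltr_leD small dist_le)).
by rewrite subrK ltxx.
Qed.

End ComplexSum.

(** * Sums over the integers of a number field *)

Definition sign_trunc (R : archiRealFieldType) (x : R) : bool * nat :=
  (0 <= x, Num.truncn `|x|).

Lemma sign_trunc_dist (R : archiRealFieldType) (x y : R) :
  sign_trunc x = sign_trunc y -> `|x - y| <= 1.
Proof.
move=> [sg tr]; have := truncn_itv (normr_ge0 x); have := truncn_itv (normr_ge0 y).
rewrite tr -natr1; case: (leP 0 x) sg => x0; case: (leP 0 y) => y0 // _.
  by rewrite (ger0_norm x0) (ger0_norm y0) ler_norml; lra.
by rewrite (ltr0_norm x0) (ltr0_norm y0) ler_norml; lra.
Qed.

Section LatticeSum.

Variables (R : realType) (F : fieldExtType rat) (n : nat).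
Variable sigma : 'I_n -> {rmorphism F -> R}.
Hypothesis degF : \dim {:F} = n.
Hypothesis sigma_distinct : distinct_morphisms sigma.

Lemma size_sign_trunc_class (s t : seq F) :
  bounded_integers sigma 1 `<=` [set` t] -> uniq s -> {in s, forall x, integers x} ->
  {in s &, forall x y j, sign_trunc (sigma j x) = sign_trunc (sigma j y)} ->
  (size s <= size t)%N.
Proof.
case: s => [//|x0 s] box_t s_uniq sO same.
rewrite -(size_map (fun x => x - x0)); apply: uniq_leq_size.
  by rewrite map_inj_uniq //; exact: addIr.
move=> _ /mapP[x xs ->]; apply: box_t; split=> [|j].
  by apply: integral_sub; apply: sO; rewrite ?mem_head.
by rewrite rmorphB; apply/sign_trunc_dist/same; rewrite ?mem_head.
Qed.

Variables (w : R -> R) (W : R).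
Hypothesis w_ge0 : forall x, 0 <= w x.
Hypothesis w_anti : forall x y, `|x| <= `|y| -> w y <= w x.
Hypothesis w_sum : forall N, \sum_(i < N) w i%:R <= W.

Lemma sum_sign_trunc_prod_le (N : nat) :
  \sum_(q : {ffun 'I_n -> bool * 'I_N}) \prod_j w (q j).2%:R <= (2 * W) ^+ n.
Proof.
rewrite -(bigA_distr_bigA (fun (_ : 'I_n) (q : bool * 'I_N) => w q.2%:R)).
rewrite prodr_const card_ord lerXn2r ?nnegrE ?sumr_ge0 //.
  by rewrite mulr_ge0 // (le_trans _ (w_sum 0)) // big_ord0.
rewrite -(pair_bigA _ (fun (_ : bool) (i : 'I_N) => w i%:R)) /= sumr_const card_bool.
by rewrite -[leLHS]mulr_natl ler_wpM2l ?w_sum.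
Qed.

(* Integers whose conjugates have the same signs and integral parts differ by one of
   the finitely many integers in the unit box. *)
Lemma esum_integers_prod_lty :
  (\esum_(x in @integers F) (\prod_j w (sigma j x))%:E < +oo)%E.
Proof.
have [t tE] := (finite_seqP _).1 (finite_bounded_integers degF sigma_distinct 1).
apply: le_lt_trans (ltry ((size t)%:R * (2 * W) ^+ n)).
apply: esum_le_EFin => X XO.
pose N := (\max_(x <- X) \max_j (sign_trunc (sigma j x)).2).+1.
pose p x := [ffun j => ((sign_trunc (sigma j x)).1, inord (sign_trunc (sigma j x)).2)]
  : {ffun 'I_n -> bool * 'I_N}.
have pE x j : x \in X -> ((p x j).1, (p x j).2 : nat) = sign_trunc (sigma j x).
  move=> xX; rewrite ffunE /= inordK ?ltnS //.
  apply: leq_trans (leq_bigmax (F := fun j => (sign_trunc (sigma j x)).2) j) _.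
  exact: (leq_bigmax_seq (F := fun x => \max_j (sign_trunc (sigma j x)).2)%N).
rewrite (partition_big p predT) //=.
apply: le_trans (ler_wpM2l (ler0n _ _) (sum_sign_trunc_prod_le N)).
rewrite mulr_sumr; apply: ler_sum => q _.
apply: (@le_trans _ _ (\sum_(x <- X | p x == q) \prod_j w (q j).2%:R)).
  rewrite big_seq_cond [leRHS]big_seq_cond; apply: ler_sum => x /andP[xX /eqP <-].
  apply: ler_prod => j _; rewrite w_ge0 w_anti // normr_nat.
  have [_ ->] := pE x j xX.
  by have /andP[] := truncn_itv (normr_ge0 (sigma j x)).
rewrite big_const_seq iter_addr_0 -[leLHS]mulr_natl ler_wpM2r ?prodr_ge0 //.
rewrite ler_nat -size_filter; apply: size_sign_trunc_class.
- by rewrite tE.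
- by rewrite filter_uniq ?fset_uniq.
- by move=> x; rewrite mem_filter => /andP[_ /XO].
- move=> x y; rewrite !mem_filter => /andP[/eqP px xX] /andP[/eqP py yX] j.
  by rewrite -!pE // px py.
Qed.

End LatticeSum.

Section Weight.

Variable R : realType.
Implicit Types x y : R.

(* (1 + |x|)^(-3/2): the exponent exceeds 1, and a weight k_j >= 3 provides two such
   factors. *)
Definition weight x : R := Num.sqrt (1 + `|x|) ^- 3.

Lemma weight_ge0 x : 0 <= weight x.
Proof. by rewrite invr_ge0 exprn_ge0 ?sqrtr_ge0. Qed.

Lemma weight_anti x y : `|x| <= `|y| -> weight y <= weight x.
Proof.
move=> xy; rewrite lef_pV2 ?posrE ?exprn_gt0 ?sqrtr_gt0 ?ltr_pwDl //.
by rewrite lerXn2r ?nnegrE ?sqrtr_ge0 // ler_wsqrtr // lerD2l.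
Qed.

Lemma sqr_weight x : weight x ^+ 2 = (1 + `|x|) ^- 3.
Proof. by rewrite exprVn exprAC sqr_sqrtr ?addr_ge0. Qed.

(* The sum telescopes against 2 / sqrt (i + 1). *)
Lemma sum_weight_le (N : nat) : \sum_(i < N) weight i%:R <= 3.
Proof.
suff sum_le : \sum_(i < N.+1) weight i%:R <= 3 - 2 / Num.sqrt N.+1%:R.
  rewrite (le_trans (y := \sum_(i < N.+1) weight i%:R)) //.
    by rewrite big_ord_recr lerDl weight_ge0.
  by apply: le_trans sum_le _; rewrite gerBl divr_ge0 // sqrtr_ge0.
elim: N => [|N IH].
  by rewrite big_ord_recl big_ord0 addr0 /weight normr0 addr0 sqrtr1 expr1n invr1; lra.
rewrite big_ord_recr /=; apply: le_trans (lerD IH (lexx _)) _.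
rewrite /weight normr_nat nat1r.
set r := Num.sqrt N.+1%:R; set s := Num.sqrt N.+2%:R.
have r0 : 0 < r by rewrite sqrtr_gt0 ltr0n.
have s0 : 0 < s by rewrite sqrtr_gt0 ltr0n.
have s2 : s ^+ 2 = r ^+ 2 + 1 by rewrite !sqr_sqrtr // [in LHS]mulrSr.
have rs : r <= s by rewrite ler_wsqrtr // ler_nat.
have gap_ge : 1 <= 2 * s * (s - r) by nra.
have num_ge0 : r <= 2 * s ^+ 2 * (s - r) by nra.
rewrite -subr_ge0.
have -> : 3 - 2 / s - (3 - 2 / r + s ^- 3) =
    (2 * s ^+ 2 * (s - r) - r) / (r * s ^+ 3).
  by field; rewrite ?gt_eqF.
by rewrite divr_ge0 ?subr_ge0 // mulr_ge0 ?exprn_ge0 // ltW.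
Qed.

End Weight.

(** * Sums over bottom rows *)

Lemma exprn_le_expR (R : realType) (x : R) (k : nat) : 0 <= x ->
  x ^+ k <= k`!%:R * expR x.
Proof.
move=> x0; case: k => [|k].
  by rewrite expr0 mul1r -expR0 ler_expR.
rewrite mulrC -ler_pdivrMr ?ltr0n ?fact_gt0 //.
by apply: le_trans (expR_ge1Dxn k x0); rewrite lerDr.
Qed.

Lemma mul_expRN_le (R : realType) (K e : R) : 0 < e -> K * expR (- (K / e)) <= e.
Proof.
move=> e0; rewrite expRN ler_pdivrMr ?expR_gt0 //.
apply: le_trans (ler_wpM2l (ltW e0) (expR_ge1Dx _)).
by rewrite mulrDr mulr1 mulrC divfK ?gt_eqF // lerDr ltW.
Qed.

Lemma invX_expRN_le (R : realType) (c r : R) (k l : nat) :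
  0 < c -> 0 < r -> (l <= k)%N ->
  r ^- k * expR (- (c / r ^+ 2)) <= (1 + k`!%:R / c ^+ k) / Num.max 1 r ^+ l.
Proof.
move=> c0 r0 lk; have K0 : 0 <= k`!%:R / c ^+ k by rewrite divr_ge0 ?exprn_ge0 // ltW.
have [r1|/ltW r1] := leP r 1.
  rewrite expr1n divr1.
  apply: le_trans (_ : k`!%:R / c ^+ k <= _); last by rewrite lerDr.
  rewrite expRN ler_pdivlMr ?exprn_gt0 // mulrAC ler_pdivrMr ?expR_gt0 //.
  apply: le_trans (exprn_le_expR k (divr_ge0 (ltW c0) (sqr_ge0 r))).
  rewrite mulrC exprMn exprVn ler_wpM2l ?exprn_ge0 ?(ltW c0) //.
  by rewrite lef_pV2 ?posrE ?exprn_gt0 // exprAC ler_iXnr ?exprn_ge0 ?exprn_ile1 // ltW.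
rewrite [leRHS]mulrC.
apply: le_trans (_ : r ^- k <= _).
  rewrite ler_piMr ?invr_ge0 ?exprn_ge0 ?(ltW r0) // -expR0 ler_expR oppr_le0.
  by rewrite divr_ge0 ?sqr_ge0 // ltW.
apply: le_trans (_ : r ^- l <= _).
  by rewrite lef_pV2 ?posrE ?exprn_gt0 // ler_weXn2l.
by rewrite ler_peMr ?invr_ge0 ?exprn_ge0 ?(ltW r0) // lerDl.
Qed.

Lemma max1_expN3_le_weight (R : realType) (m r x y : R) : 0 < m -> 0 < r ->
  `|x| <= r / m -> `|y| <= r / m ->
  (Num.max 1 r) ^- 3 <= (1 + m^-1) ^+ 3 * (weight x * weight y).
Proof.
move=> m0 r0 xr yr; have rm0 : 0 <= r / m by rewrite divr_ge0 // ltW.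
have max_gt0 : 0 < Num.max 1 r by rewrite lt_max ltr01.
apply: le_trans (_ : (1 + m^-1) ^+ 3 * (weight (r / m)) ^+ 2 <= _); last first.
  rewrite ler_wpM2l ?exprn_ge0 ?addr_ge0 ?invr_ge0 ?(ltW m0) // expr2.
  by rewrite ler_pM ?weight_ge0 ?weight_anti // (ger0_norm rm0).
rewrite sqr_weight (ger0_norm rm0) -exprVn -expr_div_n.
rewrite lerXn2r ?nnegrE ?divr_ge0 ?addr_ge0 ?invr_ge0 ?(ltW m0) ?(ltW max_gt0) //.
rewrite ler_pdivlMr ?ltr_pwDl // mulrC ler_pdivrMr // mulrDl mul1r.
rewrite [_ * Num.max _ _]mulrC lerD ?le_max ?lexx //.
by rewrite ler_wpM2r ?invr_ge0 ?(ltW m0) // le_max lexx orbT.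
Qed.

Section RowTerm.

Variables (R : realType) (F : fieldExtType rat) (n : nat).
Variables (sigma : 'I_n -> {rmorphism F -> R}) (k : 'I_n -> nat).
Implicit Types (c : R) (y : 'I_n -> R) (p : F * F).

(* |gamma_j z_j + delta_j| for z = i y and p = (gamma, delta) *)
Definition row_norm y p (j : 'I_n) : R :=
  Num.sqrt ((sigma j p.1 * y j) ^+ 2 + sigma j p.2 ^+ 2).

Definition row_term c y p : R :=
  \prod_j (row_norm y p j ^- k j * expR (- (c / row_norm y p j ^+ 2))).

Definition row_weight p : R :=
  (\prod_j weight (sigma j p.1)) * (\prod_j weight (sigma j p.2)).

Lemma row_term_ge0 c y p : 0 <= row_term c y p.
Proof.
by apply: prodr_ge0 => j _; rewrite mulr_ge0 ?expR_ge0 // invr_ge0 exprn_ge0 ?sqrtr_ge0.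
Qed.

Lemma row_weight_ge0 p : 0 <= row_weight p.
Proof. by rewrite mulr_ge0 ?prodr_ge0 // => j _; exact: weight_ge0. Qed.

Lemma row_norm_gt0 y p (j : 'I_n) : 0 < y j -> p != (0, 0) -> 0 < row_norm y p j.
Proof.
move=> y0 p0; rewrite sqrtr_gt0 lt_neqAle addr_ge0 ?sqr_ge0 // andbT eq_sym.
apply: contra p0; rewrite paddr_eq0 ?sqr_ge0 // !expf_eq0 /= mulf_eq0 (gt_eqF y0) orbF.
by rewrite !fmorph_eq0; case: p => a b /= /andP[/eqP -> /eqP ->].
Qed.

Lemma row_factor_le c y (j : 'I_n) : 0 < c -> 0 < y j -> (2 < k j)%N ->
  exists C : R, forall p, p != (0, 0) ->
    row_norm y p j ^- k j * expR (- (c / row_norm y p j ^+ 2)) <=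
    C * (weight (sigma j p.1) * weight (sigma j p.2)).
Proof.
move=> c0 y0 k2; pose m := Num.min (y j) 1.
have m0 : 0 < m by rewrite lt_min y0 ltr01.
exists ((1 + (k j)`!%:R / c ^+ k j) * (1 + m^-1) ^+ 3) => p p0.
have r0 := row_norm_gt0 y0 p0; apply: le_trans (invX_expRN_le c0 r0 k2) _.
rewrite -mulrA ler_wpM2l ?addr_ge0 ?divr_ge0 ?exprn_ge0 ?(ltW c0) //.
have r2 : row_norm y p j ^+ 2 = (sigma j p.1 * y j) ^+ 2 + sigma j p.2 ^+ 2.
  by rewrite sqr_sqrtr ?addr_ge0 ?sqr_ge0.
apply: max1_expN3_le_weight => //; rewrite ler_pdivlMr // -ler_sqr ?nnegrE;
  rewrite ?mulr_ge0 ?(ltW m0) ?(ltW r0) // exprMn real_normK ?num_real // r2.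
  apply: le_trans (_ : (sigma j p.1 * y j) ^+ 2 <= _); last by rewrite lerDl sqr_ge0.
  rewrite exprMn ler_wpM2l ?sqr_ge0 // lerXn2r ?nnegrE ?(ltW m0) ?(ltW y0) //.
  by rewrite ge_min lexx.
apply: le_trans (_ : sigma j p.2 ^+ 2 <= _); last by rewrite lerDr sqr_ge0.
by rewrite ler_piMr ?sqr_ge0 // exprn_ile1 ?(ltW m0) // ge_min lexx orbT.
Qed.

Lemma row_term_le c y :
  0 < c -> (forall j, 0 < y j) -> (forall j, (2 < k j)%N) ->
  exists2 C : R, 0 <= C & forall p, p != (0, 0) -> row_term c y p <= C * row_weight p.
Proof.
move=> c0 y0 k2; have [C CP] := choice (fun j => row_factor_le c0 (y0 j) (k2 j)).
exists `|\prod_j C j| => // p p0.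
apply: le_trans (ler_wpM2r (row_weight_ge0 p) (ler_norm _)).
rewrite /row_weight -!big_split; apply: ler_prod => j _; rewrite CP // andbT.
by rewrite mulr_ge0 ?expR_ge0 // invr_ge0 exprn_ge0 ?sqrtr_ge0.
Qed.

Lemma row_term0D c c' y y' (u : F) :
  row_term (c + c') y (0, u) =
  expR (- (c' * \sum_j sigma j u^-1 ^+ 2)) * row_term c y' (0, u).
Proof.
rewrite mulr_sumr -sumrN expR_sum /row_term -big_split /=; apply: eq_bigr => j _.
rewrite /row_norm /= !rmorph0 !mul0r expr0n add0r sqr_sqrtr ?sqr_ge0 // mulrCA.
by rewrite -expRD fmorphV exprVn mulrDl opprD addrC.
Qed.

Lemma row_term01 c y : row_term c y (0, 1) = expR (- (c * n%:R)).
Proof.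
have row_norm1 j : row_norm y (0, 1) j = 1.
  by rewrite /row_norm /= rmorph0 rmorph1 mul0r expr0n add0r expr1n sqrtr1.
rewrite /row_term (eq_bigr (fun=> expR (- c))) => [|j _].
  by rewrite prodr_const card_ord -expRM_natr mulNr.
by rewrite row_norm1 !expr1n invr1 mul1r mulr1.
Qed.

End RowTerm.

Definition integer_rows (F : fieldExtType rat) : set (F * F) :=
  [set p | [/\ integers p.1, integers p.2 & p != (0, 0)]].

Definition ideal_rows (F : fieldExtType rat) (I : set F) : set (F * F) :=
  [set p | [/\ I p.1, p.1 != 0 & integers p.2]].

Definition nontrivial_unit (F : fieldExtType rat) : set F :=
  [set u | [/\ integers u, integers u^-1, u != 0, u != 1 & u != -1]].

Definition unit_rows (F : fieldExtType rat) : set (F * F) :=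
  [set p | p.1 = 0 /\ nontrivial_unit p.2].

Arguments integer_rows F : clear implicits.
Arguments unit_rows F : clear implicits.

Lemma nontrivial_unitV (F : fieldExtType rat) (u : F) :
  nontrivial_unit u -> nontrivial_unit u^-1.
Proof.
move=> [uO uVO u0 u1 uN1]; split; rewrite ?invrK ?invr_eq0 ?invr_eq1 //.
by rewrite (can2_eq invrK invrK) invrN1.
Qed.

Lemma unit_rows_sub (F : fieldExtType rat) : unit_rows F `<=` integer_rows F.
Proof.
move=> [_ u] [/= -> [uO _ u0 _ _]]; split=> //=; first exact: mxpoly.integral0.
by apply: contra u0 => /eqP[->].
Qed.

Lemma ideal_rows_sub (F : fieldExtType rat) (I : set F) :
  integral_ideal I -> ideal_rows I `<=` integer_rows F.
Proof.
move=> [IO _ _ _] [g d] [/= Ig g0 dO]; split=> //=; first exact: IO.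
by apply: contra g0 => /eqP[->].
Qed.

Section RowSums.

Variables (R : realType) (F : fieldExtType rat) (n : nat).
Variables (sigma : 'I_n -> {rmorphism F -> R}) (k : 'I_n -> nat).
Implicit Types (c : R) (y : 'I_n -> R).

Definition row_sum c y (A : set (F * F)) : \bar R :=
  \esum_(p in A) (row_term sigma k c y p)%:E.

Lemma EFin_row_term_ge0 c y (p : F * F) : (0 <= (row_term sigma k c y p)%:E)%E.
Proof. by rewrite lee_fin row_term_ge0. Qed.

Lemma row_sum_ge0 c y A : (0 <= row_sum c y A)%E.
Proof. by apply: esum_ge0 => p _; exact: EFin_row_term_ge0. Qed.

Lemma row_sum_subset c y A B : A `<=` B -> (row_sum c y A <= row_sum c y B)%E.
Proof. by move=> AB; apply: le_esum_subset => // p _; exact: EFin_row_term_ge0. Qed.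

Lemma row_sumU c y A B : (row_sum c y (A `|` B) <= row_sum c y A + row_sum c y B)%E.
Proof. by apply: le_esumU => p _; exact: EFin_row_term_ge0. Qed.

Lemma row_sum_unit_rows_decay c a b y y' : 0 <= a ->
  (forall u, nontrivial_unit u -> b <= \sum_j sigma j u ^+ 2) ->
  (row_sum (c + a) y (unit_rows F) <=
   (expR (- (a * b)))%:E * row_sum c y' (unit_rows F))%E.
Proof.
move=> a0 le_b; rewrite -esumZl ?expR_ge0 //; last exact: EFin_row_term_ge0.
apply: le_esum => -[_ u] [/= -> /nontrivial_unitV/le_b b_le]; rewrite lee_fin.
rewrite (row_term0D _ _ _ _ _ y') ler_wpM2r ?row_term_ge0 // ler_expR lerN2.
by rewrite ler_wpM2l.
Qed.

Hypothesis degF : \dim {:F} = n.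
Hypothesis sigma_distinct : distinct_morphisms sigma.
Hypothesis k_gt2 : forall j, (2 < k j)%N.

Lemma esum_row_weight_lty :
  (\esum_(p in @integers F `*` @integers F) (row_weight sigma p)%:E < +oo)%E.
Proof.
have weight_lty := esum_integers_prod_lty degF sigma_distinct (@weight_ge0 R)
  (@weight_anti R) (@sum_weight_le R).
apply: (esum_setX_lty _ _ weight_lty weight_lty) => x.
all: by apply: prodr_ge0 => j _; exact: weight_ge0.
Qed.

Lemma row_sum_integer_rows_lty c y :
  0 < c -> (forall j, 0 < y j) -> (row_sum c y (integer_rows F) < +oo)%E.
Proof.
move=> c0 y0; have [C C0 CP] := row_term_le sigma c0 y0 k_gt2.
have weight0 p : (0 <= (row_weight sigma p)%:E)%E by rewrite lee_fin row_weight_ge0.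
apply: le_lt_trans (lte_mul_pinfty (x := C%:E) _ _ esum_row_weight_lty) => //.
rewrite -esumZl //.
apply: (@le_trans _ _ (\esum_(p in integer_rows F) (C%:E * (row_weight sigma p)%:E))%E).
  by apply: le_esum => p [_ _ p0]; rewrite lee_fin CP.
by apply: le_esum_subset => [p []//|p _]; rewrite mule_ge0.
Qed.

(* In these rows delta is a unit for which sum_j delta_j^(-2) exceeds n by a fixed
   gap, so their terms decay faster in c than exp(-c n). *)
Lemma row_sum_unit_rows_le : exists2 c : R, 0 < c &
  forall y, (row_sum c y (unit_rows F) <= (expR (- (c * n%:R)) / 2)%:E)%E.
Proof.
have [gap gap0 gapP] := sum_sqr_embeddings_gap degF sigma_distinct.
have sum1_lty : (row_sum 1%R (fun=> 1%R) (unit_rows F) < +oo)%E.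
  apply: le_lt_trans (row_sum_subset _ _ (@unit_rows_sub F)) _.
  exact: row_sum_integer_rows_lty.
case sum1E : (row_sum _ _ _) sum1_lty => [K| |] // _; last first.
  by have := row_sum_ge0 1 (fun=> 1) (unit_rows F); rewrite sum1E.
have K0 : 0 <= K by rewrite -lee_fin -sum1E row_sum_ge0.
pose e : R := expR (- n%:R) / 2; have e0 : 0 < e by rewrite divr_gt0 ?expR_gt0.
pose a := K / e / gap; have a0 : 0 <= a by rewrite !divr_ge0 // ltW.
exists (1 + a) => [|y]; first by rewrite ltr_pwDl.
apply: le_trans (row_sum_unit_rows_decay _ _ (fun=> 1) a0 (b := n%:R + gap) _) _.
  by move=> u [uO _ u0 u1 uN1]; exact: gapP.
rewrite sum1E -EFinM lee_fin.
have -> : expR (- (a * (n%:R + gap))) * K =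
    expR (- (a * n%:R)) * (K * expR (- (K / e))).
  by rewrite mulrDr opprD expRD divfK ?gt_eqF // mulrA mulrAC.
apply: le_trans (ler_wpM2l (expR_ge0 _) (mul_expRN_le _ e0)) _.
by rewrite mulrA -expRD mulrDl mul1r opprD addrC.
Qed.

Lemma row_sum_ideal_rows_lt c y (e : R) :
  0 < c -> (forall j, 0 < y j) -> 0 < e ->
  exists b : nat, forall I, integral_ideal I -> (b < ideal_norm I)%N ->
    (row_sum c y (ideal_rows I) < e%:E)%E.
Proof.
move=> c0 y0 e0; have [X X_fin tail_lt] :=
  esum_tail (fun p _ => EFin_row_term_ge0 c y p) (row_sum_integer_rows_lty c0 y0) e0.
have [b bP] := ideal_norm_le_finite degF sigma_distinct (finite_image fst X_fin).
exists b => I I_ideal b_lt; apply: le_lt_trans tail_lt.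
apply: row_sum_subset => p Ip; split; first exact: ideal_rows_sub Ip.
case: Ip => [Ip1 p1 _] Xp; move: b_lt.
by rewrite ltnNge (bP I p.1) //; exists p.
Qed.

End RowSums.

(** * The Poincare series *)

Section TermNorm.

Variables (R : realType) (F : fieldExtType rat) (n : nat).
Variables (sigma : 'I_n -> {rmorphism F -> R}) (k : 'I_n -> nat) (nu : F).

Import Normc.

Lemma normc_cexp (w : R[i]) : normc (cexp w) = expR (complex.Re w).
Proof.
rewrite /cexp normcM /= expr0n addr0 sqrtr_sqr cos2Dsin2 sqrtr1 mulr1.
by rewrite ger0_norm // expR_ge0.
Qed.

Lemma normc_prod (I : finType) (f : I -> R[i]) :
  normc (\prod_i f i) = \prod_i normc (f i).
Proof. by apply: (big_morph (@normc R)) => [x y|]; rewrite ?normcM ?normc1. Qed.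

Lemma normcX (w : R[i]) (m : nat) : normc (w ^+ m) = normc w ^+ m.
Proof. by elim: m => [|m IH]; rewrite ?expr0 ?normc1 // !exprS normcM IH. Qed.

Lemma Im_moebius (a b c d : R) (z : R[i]) :
  complex.Im ((a%:C * z + b%:C) / (c%:C * z + d%:C)) =
  (a * d - b * c) * complex.Im z / normc (c%:C * z + d%:C) ^+ 2.
Proof.
case: z => x y; rewrite /= sqr_sqrtr ?addr_ge0 ?sqr_ge0 //.
by ring.
Qed.

Lemma normc_poincare_term (z : 'I_n -> R[i]) (M : 'M[F]_2) : \det M = 1 ->
  normc (poincare_term sigma k nu z M) =
  \prod_j (let r := normc (denom sigma M z j) in
    r ^- k j * expR (- (2 * pi * (sigma j nu * complex.Im (z j)) / r ^+ 2))).
Proof.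
move=> detM; rewrite big_split /= normcM normc_cexp normc_prod; congr (_ * _).
  by apply: eq_bigr => j _; rewrite -exprnN normcV normcX.
rewrite -expR_sum; congr expR; set w := ztrace _ _ _.
have -> : complex.Re (2 * (pi : R)%:C * 'i%C * w) = - (2 * pi * complex.Im w).
  by case: w => a b; rewrite /=; ring.
rewrite /w /ztrace Im_sum mulr_sumr -sumrN; apply: eq_bigr => j _; congr (- _).
have -> : complex.Im ((sigma j nu)%:C * moebius sigma M z j) =
    sigma j nu * complex.Im (moebius sigma M z j).
  by case: (moebius _ _ _ _) => a b; rewrite /= mul0r addr0.
rewrite /moebius /denom Im_moebius -!rmorphM -rmorphB -det2 detM rmorph1 mul1r.
by rewrite !mulrA.
Qed.

Lemma normc_denom_imaginary (y : 'I_n -> R) (M : 'M[F]_2) (j : 'I_n) :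
  normc (denom sigma M (fun j => 0 +i* y j) j) = row_norm sigma y (M 1 0, M 1 1) j.
Proof. by rewrite /denom /row_norm /=; congr Num.sqrt; ring. Qed.

Lemma normc_poincare_term_imaginary (c : R) (y : 'I_n -> R) (M : 'M[F]_2) :
  (forall j, 2 * pi * (sigma j nu * y j) = c) -> \det M = 1 ->
  normc (poincare_term sigma k nu (fun j => 0 +i* y j) M) =
  row_term sigma k c y (M 1 0, M 1 1).
Proof.
move=> yc detM; rewrite normc_poincare_term //; apply: eq_bigr => j _.
by rewrite normc_denom_imaginary /= yc.
Qed.

End TermNorm.

Section Cosets.

Variable F : fieldExtType rat.
Implicit Types (M N U : 'M[F]_2) (C D : set 'M[F]_2) (I : set F).

Definition translation_mx (x : F) : 'M[F]_2 := 1%:M + x *: delta_mx 0 1.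

Lemma mulmx2E M N i j : (M *m N) i j = M i 0 * N 0 j + M i 1 * N 1 j.
Proof.
rewrite mxE !big_ord_recl big_ord0 addr0; congr (_ + M i _ * N _ j).
all: exact: val_inj.
Qed.

Lemma ord2P (i : 'I_2) : i = 0 \/ i = 1.
Proof. by case: i => -[|[|//]] i; [left|right]; exact: val_inj. Qed.

Lemma eq_matrix2 M N :
  [/\ M 0 0 = N 0 0, M 0 1 = N 0 1, M 1 0 = N 1 0 & M 1 1 = N 1 1] -> M = N.
Proof.
case=> e00 e01 e10 e11; apply/matrixP => i j.
by case: (ord2P i) => ->; case: (ord2P j) => ->.
Qed.

Lemma Gamma_infP U :
  Gamma_inf U <-> exists2 x, integers x & U = translation_mx x.
Proof.
split=> [[U00 U10 U11 U01]|[x xO ->]].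
  exists (U 0 1) => //; apply: eq_matrix2.
  by split; rewrite !mxE ?U00 ?U10 ?U11 /= ?mulr0 ?mulr1 ?addr0 ?add0r.
by split; rewrite /translation_mx !mxE /= ?mulr0 ?mulr1 ?addr0 ?add0r.
Qed.

Lemma translation_mxD x y :
  translation_mx (x + y) = translation_mx x *m translation_mx y.
Proof.
rewrite /translation_mx mulmxDl mul1mx mulmxDr mulmx1 -scalemxAl -scalemxAr.
by rewrite mul_delta_mx_cond scalerDl !scaler0 addr0 [x *: _ + _]addrC addrA.
Qed.

Lemma translation_mx0 : translation_mx 0 = 1%:M.
Proof. by rewrite /translation_mx scale0r addr0. Qed.

Lemma det_translation_mx x : \det (translation_mx x) = 1.
Proof. by rewrite det2 /translation_mx !mxE /=; ring. Qed.

Lemma mul_translation_mx_row0 x M j : (translation_mx x *m M) 0 j = M 0 j + x * M 1 j.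
Proof. by rewrite mulmx2E /translation_mx !mxE /=; ring. Qed.

Lemma mul_translation_mx_row1 x M j : (translation_mx x *m M) 1 j = M 1 j.
Proof. by rewrite mulmx2E /translation_mx !mxE /=; ring. Qed.

Lemma mem_coset_inf M : coset_inf M M.
Proof.
exists 1%:M; last by rewrite mul1mx.
by apply/Gamma_infP; exists 0; [exact: mxpoly.integral0|rewrite translation_mx0].
Qed.

Lemma coset_inf_translation x M :
  integers x -> coset_inf (translation_mx x *m M) = coset_inf M.
Proof.
have sub u N : integers u -> coset_inf (translation_mx u *m N) `<=` coset_inf N.
  move=> uO _ [_ /Gamma_infP[v vO ->] <-]; exists (translation_mx (v + u)).
    by apply/Gamma_infP; exists (v + u) => //; exact: integral_add.
  by rewrite translation_mxD mulmxA.
move=> xO; apply/seteqP; split; first exact: sub.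
rewrite -[X in coset_inf X `<=` _]mul1mx -translation_mx0 -(addNr x).
rewrite translation_mxD -mulmxA.
exact/sub/integral_opp.
Qed.

Lemma coset_inf_eq M N : coset_inf M N -> coset_inf N = coset_inf M.
Proof. by move=> [_ /Gamma_infP[x xO ->] <-]; exact: coset_inf_translation. Qed.

Lemma coset_inf_bottom_row M N : SL2_integers M -> SL2_integers N ->
  M 1 0 = N 1 0 -> M 1 1 = N 1 1 -> coset_inf M = coset_inf N.
Proof.
move=> [MO detM] [NO detN] e10 e11; apply: coset_inf_eq.
exists (translation_mx (M 0 1 * N 0 0 - M 0 0 * N 0 1)).
  apply/Gamma_infP; eexists; last by [].
  exact: integral_sub (integral_mul (MO 0 1) (NO 0 0)) (integral_mul (MO 0 0) (NO 0 1)).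
move: detM detN; rewrite !det2 e10 e11 => detM detN.
apply: eq_matrix2; rewrite !mul_translation_mx_row0 !mul_translation_mx_row1 e10 e11.
split=> //.
  transitivity (N 0 0 * (1 - (M 0 0 * N 1 1 - M 0 1 * N 1 0)) +
    M 0 0 * (N 0 0 * N 1 1 - N 0 1 * N 1 0)); first by ring.
  by rewrite detM detN; ring.
transitivity (N 0 1 * (1 - (M 0 0 * N 1 1 - M 0 1 * N 1 0)) +
  M 0 1 * (N 0 0 * N 1 1 - N 0 1 * N 1 0)); first by ring.
by rewrite detM detN; ring.
Qed.

Lemma coset_inf_Gamma0 I M N : Gamma0 I M -> coset_inf M N -> Gamma0 I N.
Proof.
move=> [[MO detM] MI] [_ /Gamma_infP[x xO ->] <-].
split; last by rewrite mul_translation_mx_row1.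
split=> [i j|]; last by rewrite det_mulmx det_translation_mx mul1r.
case: (ord2P i) => ->; rewrite ?mul_translation_mx_row0 ?mul_translation_mx_row1 //.
exact: integral_add (MO _ _) (integral_mul xO (MO _ _)).
Qed.

Lemma coset_inf_xget M : coset_inf M (xget 0 (coset_inf M)).
Proof. by apply: xgetPex; exists M; exact: mem_coset_inf. Qed.

Lemma quotient_inf_rep I C :
  quotient_inf I C -> Gamma0 I (xget 0 C) /\ coset_inf (xget 0 C) = C.
Proof.
move=> [M MP <-]; have M_xget := coset_inf_xget M.
by split; [exact: coset_inf_Gamma0 M_xget|exact: coset_inf_eq].
Qed.

Definition bottom_row C : F * F := (xget 0 C 1 0, xget 0 C 1 1).

Lemma bottom_row_inj I : set_inj (quotient_inf I) bottom_row.
Proof.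
move=> C D /set_mem/quotient_inf_rep[[CP _] CE] /set_mem/quotient_inf_rep[[DP _] DE].
move=> [e10 e11].
by rewrite -CE -DE; exact: coset_inf_bottom_row.
Qed.

Lemma SL2_integers1 : @SL2_integers F 1%:M.
Proof. by split=> [i j|]; [rewrite mxE; exact: integral_nat|rewrite det1]. Qed.

Lemma SL2_integersN1 : @SL2_integers F (- 1%:M).
Proof.
split=> [i j|]; first by rewrite !mxE; apply: integral_opp; exact: integral_nat.
by rewrite det2 !mxE /= !oppr0 mulrNN mulr1 mulr0 subr0.
Qed.

Lemma coset_inf1_neqN1 : coset_inf (1%:M : 'M[F]_2) != coset_inf (- 1%:M).
Proof.
apply/eqP => e; have : coset_inf (- 1%:M) (1%:M : 'M[F]_2).
  by rewrite -e; exact: mem_coset_inf.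
move=> [U [_ _ U11 _] /matrixP/(_ 1 1)/eqP].
rewrite mulmx2E !mxE /= oppr0 mulr0 add0r U11 mul1r -subr_eq0 -opprD oppr_eq0.
by rewrite -(intrD F 1 1) intr_alg_eq0.
Qed.

Definition nontrivial_cosets I : set (set 'M[F]_2) :=
  quotient_inf I `\` [set coset_inf 1%:M; coset_inf (- 1%:M)].

Lemma bottom_row_nontrivial I C :
  nontrivial_cosets I C -> (unit_rows F `|` ideal_rows I) (bottom_row C).
Proof.
move=> [/quotient_inf_rep[]]; rewrite /bottom_row; set M := xget 0 C.
move=> [[MO detM] MI] <- /not_orP[C1 CN1].
have [M10|M10] := eqVneq (M 1 0) 0; last by right; split; last exact: MO.
left; split=> //=; have MP : SL2_integers M by [].
have det1M : M 0 0 * M 1 1 = 1 by rewrite -detM det2 M10 mulr0 subr0.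
have M11 : M 1 1 != 0.
  by apply: contra_eq_neq det1M => ->; rewrite mulr0 eq_sym oner_neq0.
split; [exact: MO| |exact: M11| |].
- by rewrite -[(M 1 1)^-1]mul1r -det1M mulfK //; exact: MO.
- apply/eqP => M11E; apply: C1; apply: coset_inf_bottom_row => //.
  + exact: SL2_integers1.
  + by rewrite M10 mxE.
  + by rewrite M11E mxE.
- apply/eqP => M11E; apply: CN1; apply: coset_inf_bottom_row => //.
  + exact: SL2_integersN1.
  + by rewrite M10 !mxE /= oppr0.
  + by rewrite M11E !mxE.
Qed.

End Cosets.

Section Poincare.

Variables (R : realType) (F : fieldExtType rat) (n : nat).
Variables (sigma : 'I_n -> {rmorphism F -> R}) (k : 'I_n -> nat) (nu : F).

Import Normc.

Lemma poincare_term_rep (z : 'I_n -> R[i]) (M : 'M[F]_2) :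
  dual_integers sigma nu -> upper_half z -> \det M = 1 ->
  poincare_term sigma k nu z (xget 0 (coset_inf M)) = poincare_term sigma k nu z M.
Proof.
move=> nu_dual z_upper detM; have [U U_inf <-] := coset_inf_xget M.
exact: poincare_term_coset.
Qed.

(* As sum_j k_j is even, the cosets of 1 and -1 contribute equal terms. *)
Lemma poincare_neq0 (I : set F) (z : 'I_n -> R[i]) :
  integral_ideal I -> ~~ odd (\sum_j k j)%N -> dual_integers sigma nu ->
  upper_half z ->
  (\esum_(C in nontrivial_cosets I)
     (normc (poincare_term sigma k nu z (xget 0 C)))%:E <
   (normc (poincare_term sigma k nu z 1%:M) *+ 2)%:E)%E ->
  poincare sigma k nu I z <> 0.
Proof.
move=> [_ I0 _ _] k_even nu_dual z_upper tail_lt.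
have [SL1 SLN1] := (SL2_integers1 F, SL2_integersN1 F).
have Q1 : coset_inf 1%:M \in quotient_inf I.
  by apply: mem_set; exists 1%:M; split; rewrite ?mxE.
have QN1 : coset_inf (- 1%:M) \in quotient_inf I.
  by apply: mem_set; exists (- 1%:M); split; rewrite ?mxE ?oppr0.
pose X := [fset coset_inf (1%:M : 'M[F]_2); coset_inf (- 1%:M)]%fset.
have nontrivialE : nontrivial_cosets I = ~` [set` X] `&` quotient_inf I.
  by rewrite set_fsetU !set_fset1 setIC -setDE.
apply: (@summability_sum_neq0 _ _ _ X).
rewrite big_fsetU1 ?inE ?coset_inf1_neqN1 // big_seq_fset1 /=.
rewrite Q1 QN1 !poincare_term_rep ?(SL1.2) ?(SLN1.2) // poincare_termN -signr_odd.
rewrite (negPf k_even) mul1r -mulr2n normcMn; apply: le_lt_trans tail_lt.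
rewrite nontrivialE esum_mkcondr; apply: le_esum => C _; case: ifP => // _.
by rewrite normc0.
Qed.

Lemma esum_nontrivial_cosets_le (I : set F) (c : R) (y : 'I_n -> R) :
  (forall j, 2 * pi * (sigma j nu * y j) = c) ->
  (\esum_(C in nontrivial_cosets I)
     (normc (poincare_term sigma k nu (fun j => 0 +i* y j) (xget 0 C)))%:E <=
   row_sum sigma k c y (unit_rows F) + row_sum sigma k c y (ideal_rows I))%E.
Proof.
move=> yc; rewrite (eq_esum (b := fun C => (row_term sigma k c y (bottom_row C))%:E)).
  rewrite -(@esum_image _ _ _ _ _ (fun p => (row_term sigma k c y p)%:E)) => [|C D].
    apply: le_trans (row_sumU _ _ _ _ _ _); apply: row_sum_subset.
    by move=> _ [C CP <-]; exact: bottom_row_nontrivial.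
  move=> /set_mem[CQ _] /set_mem[DQ _].
  by apply: (@bottom_row_inj F I); exact: mem_set.
move=> C [/quotient_inf_rep[[[_ detC] _] _] _].
by rewrite (normc_poincare_term_imaginary _ yc).
Qed.

End Poincare.

Theorem theorem4p4 (R : realType) (F : fieldExtType rat) (n : nat)
    (sigma : 'I_n -> {rmorphism F -> R})
    (degF : \dim {:F} = n)
    (realF : totally_real R F)
    (sigmaP : enumerates_real_embeddings sigma)
    (k : 'I_n -> nat)
    (k_gt2 : forall j, (2 < k j)%N)
    (k_even : ~~ odd (\sum_j k j)%N)
    (nu : F)
    (nu_dual : dual_integers sigma nu)
    (nu_pos : totally_positive sigma nu) :
  exists n0 : R, 0 < n0 /\
    forall I : set F, integral_ideal I -> I <> [set 0] ->
      n0 <= (ideal_norm I)%:R ->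
      exists z : 'I_n -> R[i],
        upper_half z /\ poincare sigma k nu I z <> 0.
Proof.
have [sigma_distinct _] := sigmaP.
have [c c0 unit_le] := row_sum_unit_rows_le degF sigma_distinct k_gt2.
pose y j := c / (2 * pi * sigma j nu).
have nu2pi_gt0 j : 0 < 2 * pi * sigma j nu by rewrite !mulr_gt0 ?pi_gt0.
have y_gt0 j : 0 < y j by rewrite divr_gt0.
have yc j : 2 * pi * (sigma j nu * y j) = c by rewrite mulrA mulrC divfK ?gt_eqF.
have half_gt0 : 0 < expR (- (c * n%:R)) / 2 by rewrite divr_gt0 ?expR_gt0.
have [b ideal_lt] := row_sum_ideal_rows_lt degF sigma_distinct k_gt2 c0 y_gt0 half_gt0.
exists b.+1%:R; split=> [|I I_ideal _]; first by rewrite ltr0n.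
have z_upper : upper_half (fun j => 0 +i* y j) by move=> j; exact: y_gt0.
rewrite ler_nat => b_lt; exists (fun j => 0 +i* y j); split=> //.
apply: poincare_neq0 => //; apply: le_lt_trans (esum_nontrivial_cosets_le k I yc) _.
rewrite (normc_poincare_term_imaginary _ yc) ?det1 // !mxE row_term01.
apply: le_lt_trans (leeD (unit_le y) (ltW (ideal_lt I I_ideal b_lt))) _.
by rewrite -EFinD lte_fin -splitr mulr2n ltrDl expR_gt0.
Qed.
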